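(* Let $\alpha>2$ and $\gamma>0$. Then there exist an integer $K\ge1$ and deterministic localization sequences $\delta_n^{(1)},\dots,\delta_n^{(K)}>0$ tending to $0$ (depending only on $\alpha$ and $\gamma$) such that the following holds. Assume that $f$ satisfies: (A1) $f$ extends to $D^\varepsilon$ for some $\varepsilon>0$ and belongs to the isotropic Hölder class $\mathcal{H}_d(\alpha,L,D^\varepsilon)$ with $L>0$; (A2) there is a unique point $\mu$ in the interior of $D$ that maximizes $f$ on $D$, with $M=f(\mu)=\sup_{x\in D}f(x)$, and $\lambda_{\max}(Hf(\mu))<0$. If the preliminary estimator satisfies $\|\hat\mu^{(0)}-\mu\|=O_p(n^{-\gamma})$, then the multi-stage estimator obtained by iterating the second-stage operation $K$ times satisfies, as $n\to\infty$, $$\|\hat\mu^{(K)}-\mu\|=O_p\bigl(n^{-(\alpha-1)/(2\alpha)}\bigr),\qquad \hat M^{(K)}-M=O_p\bigl(n^{-1/2}\bigr).$$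
   Context: Notation. $\|\cdot\|$ is the Euclidean norm on $\mathbb{R}^d$. For a multi-index $\mathbf{i}\in\mathbb{N}^d$ ($0\in\mathbb{N}$), $|\mathbf{i}|=\sum_k i_k$, $\mathbf{i}!=\prod_k i_k!$, $x^{\mathbf{i}}=\prod_k x_k^{i_k}$, $\mathbf{D}^{\mathbf{i}}f$ is the corresponding partial derivative. $Hf(x)$ is the Hessian matrix of $f$ at $x$; $\lambda_{\max}$ is the largest eigenvalue. $r_\alpha=\lceil\alpha-1\rceil$ is the largest integer strictly less than $\alpha$; $\mathbb{I}=\{\mathbf{i}\in\mathbb{N}^d: |\mathbf{i}|\le r_\alpha\}$. For $a\in\mathbb{R}^d$, $\delta>0$, $C(a,\delta)=\prod_{k=1}^d[a_k-\delta,a_k+\delta]$. $O_p$ denotes boundedness in probability as $n\to\infty$. Hölder class. $D\subset\mathbb{R}^d$ is compact and convex, $D^\varepsilon=\bigcup_{x\in D}B(x,\varepsilon)$ with $B(x,\varepsilon)$ the closed ball. $\mathcal{H}_d(\alpha,L,D^\varepsilon)$ is the set of $r_\alpha$-times differentiable $f:D^\varepsilon\to\mathbb{R}$ with $|f(x)-P_{f,x_0}(x)|\le L\|x-x_0\|^\alpha$ for all $x,x_0\in D^\varepsilon$, where $P_{f,x_0}(x)=\sum_{\mathbf{i}\in\mathbb{I}}\frac{1}{\mathbf{i}!}\mathbf{D}^{\mathbf{i}}f(x_0)(x-x_0)^{\mathbf{i}}$. Model. One can observe $Y=f(x)+\xi$ at chosen design points $x$; the errors $\xi$ of different observations are independent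 with mean zero and variance $\sigma^2$. (If a design point falls outside $D^\varepsilon$, $f$ is set to $0$ there.) Multi-stage procedure. Split the budget as $n=n^{(0)}+n^{(1)}+\dots+n^{(K)}$ with each $n^{(j)}/n$ converging to a positive limit, and $n^{(j)}=m^{(j)}(2l+1)^d$ with $m^{(j)}\in\mathbb{N}$ for $j\ge1$, where $l$ is the smallest integer with $2l\ge r_\alpha$. The preliminary estimator $\hat\mu^{(0)}$ of $\mu$ is a $D$-valued measurable function of $n^{(0)}$ initial observations. For $j=1,\dots,K$ the second-stage operation is applied to $\hat\mu^{(j-1)}$ with localization parameter $\delta_n^{(j)}$: one takes $n^{(j)}$ new observations $(x_k,Y_k)$, with errors independent of all earlier data, at each of the $(2l+1)^d$ points of $\prod_{k=1}^d\{\hat\mu^{(j-1)}_k+i\delta^{(j)}_n: i=0,\pm1,\dots,\pm l\}$, each repeated $m^{(j)}$ times; with $f_\vartheta(x)=\sum_{\mathbf{i}\in\mathbb{I}}\vartheta_{\mathbf{i}}x^{\mathbf{i}}$, one lets $\tilde\vartheta^{(j)}$ be the (unique) least squares minimizer of $\sum_k(Y_k-f_\vartheta(x_k))^2$ over these new observations, and puts $\hat\mu^{(j)}=\arg\max_{x\in C(\hat\mu^{(j-1)},\,l\delta_n^{(j)})}f_{\tilde\vartheta^{(j)}}(x)$ (any measurable maximizer) and $\hat M^{(j)}=f_{\tilde\vartheta^{(j)}}(\hat\mu^{(j)})$. *)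

(* Defs.v *)
From HB Require Import structures.
From mathcomp Require Import all_boot all_order all_algebra finmap.
From mathcomp Require Import all_classical all_reals all_analysis.

Set Implicit Arguments.
Unset Strict Implicit.
Unset Printing Implicit Defensive.

Import Order.TTheory GRing.Theory Num.Theory.
Import numFieldNormedType.Exports.

Local Open Scope classical_set_scope.
Local Open Scope ring_scope.

Section Euclidean.
Context {R : realType} {d : nat}.
Implicit Types (x a : 'rV[R]_d) (D S : set 'rV[R]_d) (f : 'rV[R]_d -> R).

(* The library norm on row vectors is the sup norm. *)
Definition enorm x : R := Num.sqrt (\sum_k x 0 k ^+ 2).

Definition fattening D (eps : R) : set 'rV[R]_d :=
  [set y | exists2 x, D x & enorm (y - x) <= eps].

Definition cube a (delta : R) : set 'rV[R]_d :=
  [set y | forall k, a 0 k - delta <= y 0 k <= a 0 k + delta].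

Definition evec (k : 'I_d) : 'rV[R]_d := delta_mx 0 k.

Definition hessian f x : 'M[R]_d :=
  \matrix_(i, j) 'D_(evec j) (fun z => 'D_(evec i) f z) x.

(* The set of eigenvalues is finite, so that the supremum is a maximum
   whenever there is one (in particular, for symmetric matrices with d > 0). *)
Definition lambda_max (A : 'M[R]_d) : R := sup [set a : R | eigenvalue A a].

(* [f] is differentiable at [x] as a function on [S], with gradient [g]; at an
   interior point of [S] this is the usual (Frechet) differentiability. *)
Definition gradient_within S f x (g : 'rV[R]_d) : Prop :=
  forall e : R, 0 < e -> \forall y \near within S (nbhs x),
    `|f y - f x - \sum_k g 0 k * (y 0 k - x 0 k)| <= e * enorm (y - x).

End Euclidean.

(* Multi-indices of arbitrary order, and the finite set of those of order at
   most r. *)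
Notation multiindex d := {ffun 'I_d -> nat}.
Notation bmultiindex r d :=
  {i : {ffun 'I_d -> 'I_r.+1} | (\sum_(k < d) i k <= r)%N}.

Section Holder.
Context {R : realType} {d : nat}.
Implicit Types (x : 'rV[R]_d) (S : set 'rV[R]_d) (f : 'rV[R]_d -> R).

Definition mi_order (i : multiindex d) : nat := (\sum_k i k)%N.

Definition mi_succ (i : multiindex d) (k : 'I_d) : multiindex d :=
  [ffun c => (i c + (c == k))%N].

Definition mi_val r (i : bmultiindex r d) : multiindex d :=
  [ffun k => nat_of_ord (val i k)].

Definition mi_fact (i : multiindex d) : nat := (\prod_k (i k)`!)%N.

Definition monomial x (i : multiindex d) : R := \prod_k x 0 k ^+ i k.

(* [f] is r times differentiable on [S], where [Df i] is the partial derivative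
   of order [i], for every multi-index [i] of order at most r. When [S] is
   convex with nonempty interior, these [Df i] are uniquely determined on the
   whole of [S], its boundary included. *)
Definition partials S (r : nat) f (Df : multiindex d -> 'rV[R]_d -> R) : Prop :=
  (forall x, S x -> Df [ffun=> 0%N] x = f x) /\
  (forall i, (mi_order i < r)%N -> forall x, S x ->
     gradient_within S (Df i) x (\row_k Df (mi_succ i k) x)).

Definition taylor (r : nat) (Df : multiindex d -> 'rV[R]_d -> R) x0 x : R :=
  \sum_(i : bmultiindex r d)
    (mi_fact (mi_val i))%:R^-1 * Df (mi_val i) x0 * monomial (x - x0) (mi_val i).

(* The largest integer strictly less than [alpha] (for [0 < alpha]). *)
Definition holder_degree (alpha : R) : nat := `|Num.ceil (alpha - 1)|%N.

Definition holder_class (alpha L : R) S : set ('rV[R]_d -> R) :=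
  [set f | exists Df,
    partials S (holder_degree alpha) f Df /\
    forall x x0, S x -> S x0 ->
      `|f x - taylor (holder_degree alpha) Df x0 x|
        <= L * enorm (x - x0) `^ alpha].

End Holder.

Section Probability.
Context {disp : measure_display} {Om : measurableType disp} {R : realType}.
Variable P : probability Om R.

Definition mutually_independent (I : choiceType) (J : set I)
    (X : I -> {RV P >-> R}) : Prop :=
  forall (F : {fset I}) (A : I -> set R), [set` F] `<=` J ->
    (forall i, measurable (A i)) ->
    P (\bigcap_(i in [set` F]) (X i @^-1` A i)) =
    (\prod_(i <- F) P (X i @^-1` A i))%E.

Definition independent_systems (G H : set (set Om)) : Prop :=
  forall A B, G A -> H B -> P (A `&` B) = (P A * P B)%E.

(* X_n = O_p(a_n). The measurable cover [A] is only there so that the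
   definition makes sense without measurability assumptions on [X]. *)
Definition bounded_in_prob (X : nat -> Om -> R) (a : nat -> R) : Prop :=
  forall e : R, 0 < e -> exists2 C : R, 0 < C & \forall n \near \oo,
    exists A : set Om, [/\ measurable A,
      [set w | C * a n < `|X n w|] `<=` A & (P A <= e%:E)%E].

End Probability.

(* In all that follows the total sample size is fixed, and the observations are
   numbered by a stage i (0 for the preliminary stage) and a k < N i. *)
Section SigmaAlgebras.
Context {disp : measure_display} {Om : measurableType disp} {R : realType}.
Context {d : nat}.

Definition generated_by (X : Om -> R) : set (set Om) :=
  preimage_set_system setT X measurable.

(* sigma-algebra of the data (x_{i,k}, Y_{i,k}) collected before stage j *)
Definition data_before (N : nat -> nat) (x : nat -> nat -> Om -> 'rV[R]_d)
    (Y : nat -> nat -> Om -> R) (j : nat) : set (set Om) :=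
  <<s [set E | exists i k, [/\ (i < j)%N, (k < N i)%N &
         (exists c, generated_by (fun w => x i k w 0 c) E) \/
         generated_by (Y i k) E]] >>.

Definition errors_at (N : nat -> nat) (xi : nat -> nat -> Om -> R) (j : nat) :
    set (set Om) :=
  <<s [set E | exists2 k, (k < N j)%N & generated_by (xi j k) E] >>.

Definition measurable_wrt (G : set (set Om)) (X : Om -> 'rV[R]_d) : Prop :=
  forall c A, generated_by (fun w => X w 0 c) A -> G A.

End SigmaAlgebras.

(* The coordinates of a grid label range over 0, ..., 2 l and encode the
   integers -l, ..., l. *)
Notation grid d l := {ffun 'I_d -> 'I_(l.*2).+1}.

Section SecondStage.
Context {R : realType} {d : nat}.

(* smallest l with r <= 2 * l *)
Definition grid_radius (r : nat) : nat := uphalf r.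

Definition grid_point (l : nat) (a : 'rV[R]_d) (delta : R) (g : grid d l) :
    'rV[R]_d :=
  \row_c (a 0 c + ((g c)%:R - l%:R) * delta).

Definition poly_fun (r : nat) (theta : {ffun bmultiindex r d -> R})
    (x : 'rV[R]_d) : R :=
  \sum_i theta i * monomial x (mi_val i).

Definition rss (r N : nat) (x : nat -> 'rV[R]_d) (Y : nat -> R)
    (theta : {ffun bmultiindex r d -> R}) : R :=
  \sum_(k < N) (Y k - poly_fun theta (x k)) ^+ 2.

Definition least_squares (r N : nat) (x : nat -> 'rV[R]_d) (Y : nat -> R)
    (theta : {ffun bmultiindex r d -> R}) : Prop :=
  forall theta' : {ffun bmultiindex r d -> R},
    rss N x Y theta <= rss N x Y theta'.

Definition is_argmax (S : set 'rV[R]_d) (h : 'rV[R]_d -> R) (x : 'rV[R]_d) :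
    Prop :=
  S x /\ forall y, S y -> h y <= h x.

End SecondStage.

(* Main.v *)
Require Import Defs.
From HB Require Import structures.
From mathcomp Require Import all_boot all_order all_algebra finmap.
From mathcomp Require Import all_classical all_reals all_analysis.
From mathcomp Require Import measurable_realfun ring lra zify.

Set Implicit Arguments.
Unset Strict Implicit.
Unset Printing Implicit Defensive.

Import Order.TTheory GRing.Theory Num.Theory.
Import numFieldNormedType.Exports.

Local Open Scope classical_set_scope.
Local Open Scope ring_scope.

(** Let [P] be the Taylor polynomial of [f] at the maximizer [mu]. It lies in the
    regression space, so one comparison of residual sums of squares bounds
    the grid values of [g = f_theta - P] by the Hoelder bias [O(delta^alpha)] plus
    the averaged noise [O_p(n^(-1/2))]. The noise bound is Chebyshev's inequality
    for fixed linear combinations of the errors, so no conditioning on the earlier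
    stages is needed. Tensor Lagrange interpolation on the rescaled grid
    turns this into a uniform bound [E] on [g] and a Lipschitz bound [E / delta].
    As [P (mu + h) <= f mu - c |h|^2] near [mu], optimality of the new
    estimator gives [c |h|^2 <= C E |h| / delta], that is,
    [|h| = O_p(delta^(alpha-1))] whenever [n^(-1/2) <= delta^alpha].
    With [delta = n^(-beta)] a stage improves the rate [n^(-b)], [b > beta], to
    [n^(-beta (alpha-1))]; since [alpha - 1 > alpha / 2 > 1], the exponents
    [beta_j = min (1 / (2 alpha), (gamma / 2) (alpha / 2)^(j-1))] can be
    used in turn, and they reach [1 / (2 alpha)] after finitely many stages. *)

(** * The Euclidean norm on row vectors *)

Section EuclideanNorm.
Context {R : realType} {d : nat}.
Implicit Types x y : 'rV[R]_d.

Lemma enorm_ge0 x : 0 <= enorm x.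
Proof. exact: sqrtr_ge0. Qed.

Lemma sqr_enorm x : enorm x ^+ 2 = \sum_k x 0 k ^+ 2.
Proof. by rewrite sqr_sqrtr// sumr_ge0// => k _; exact: sqr_ge0. Qed.

Lemma ler_coord_enorm x k : `|x 0 k| <= enorm x.
Proof.
rewrite -sqrtr_sqr ler_sqrt ?sumr_ge0// => [|i _]; last exact: sqr_ge0.
by rewrite (bigD1 k)//= lerDl sumr_ge0// => i _; exact: sqr_ge0.
Qed.

Lemma enorm_le_sum x : enorm x <= \sum_k `|x 0 k|.
Proof.
have h0 (P : pred 'I_d) : 0 <= \sum_(k | P k) `|x 0 k|.
  by rewrite sumr_ge0.
rewrite -(@ler_sqr R) ?nnegrE ?enorm_ge0// sqr_enorm expr2 big_distrl/=.
apply: ler_sum => k _; rewrite -real_normK ?num_real// expr2 ler_wpM2l//.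
by rewrite (bigD1 k)//= lerDl.
Qed.

Lemma enorm_le_unif x (e : R) : (forall k, `|x 0 k| <= e) -> enorm x <= d%:R * e.
Proof.
move=> h; apply: le_trans (enorm_le_sum x) _.
have -> : d%:R * e = \sum_(k < d) e by rewrite sumr_const card_ord mulr_natl.
by apply: ler_sum => k _.
Qed.

Lemma enorm0 : enorm (0 : 'rV[R]_d) = 0.
Proof. by rewrite /enorm big1 ?sqrtr0// => k _; rewrite mxE expr0n. Qed.

Lemma enorm_eq0 x : (enorm x == 0) = (x == 0).
Proof.
apply/eqP/eqP => [h|->]; last exact: enorm0.
apply/rowP => k; rewrite mxE; apply/eqP; rewrite -normr_le0.
by have := ler_coord_enorm x k; rewrite h.
Qed.

Lemma enormZ (a : R) x : enorm (a *: x) = `|a| * enorm x.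
Proof.
apply/eqP; rewrite -(@eqrXn2 _ 2)// ?mulr_ge0 ?enorm_ge0//.
rewrite exprMn !sqr_enorm real_normK ?num_real// mulr_sumr.
by apply/eqP/eq_bigr => k _; rewrite mxE exprMn.
Qed.

Lemma enorm_evec k : enorm (evec k : 'rV[R]_d) = 1.
Proof.
rewrite /enorm (bigD1 k)//= big1 => [|i ik]; rewrite !mxE !eqxx/=.
  by rewrite expr1n addr0 sqrtr1.
by rewrite (negbTE ik) expr0n.
Qed.

End EuclideanNorm.

(** * Translation invariance of the regression space *)

Section PolyFun.
Context {R : realType} {d : nat}.
Implicit Types (x y : 'rV[R]_d).

Lemma sum_bmultiindex r (F : {ffun 'I_d -> 'I_r.+1} -> R) :
  \sum_(i : bmultiindex r d) F (val i) =
  \sum_(j : {ffun 'I_d -> 'I_r.+1} | (\sum_(k < d) j k <= r)%N) F j.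
Proof. exact: (esym (big_sub [pred j : {ffun 'I_d -> 'I_r.+1} | (\sum_(k < d) j k <= r)%N] F)). Qed.

Lemma poly_funB r (t1 t2 : {ffun bmultiindex r d -> R}) x :
  poly_fun [ffun i => t1 i - t2 i] x = poly_fun t1 x - poly_fun t2 x.
Proof.
by rewrite /poly_fun -sumrB; apply: eq_bigr => i _; rewrite ffunE mulrBl.
Qed.

(** Coefficients are padded with zeros up to degree [r], so that all coordinates share one summation
    range and a product over coordinates can be distributed. *)
Lemma exprB_expand r (a b : R) i : (i <= r)%N ->
  (a - b) ^+ i =
  \sum_(j < r.+1) (if (j <= i)%N then (- b) ^+ (i - j) *+ 'C(i, j) else 0) * a ^+ j.
Proof.
move=> ir; rewrite addrC exprDn.
rewrite (big_ord_widen_cond _ predT (fun j => (- b) ^+ (i - j) * a ^+ j *+ 'C(i, j)) (ir : (i.+1 <= r.+1)%N))/=.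
rewrite big_mkcond/=; apply: eq_bigr => j _; rewrite ltnS.
by case: ifP => _; rewrite ?mul0r// mulrnAl.
Qed.

Lemma monomialB_poly r z (i : bmultiindex r d) :
  exists t : {ffun bmultiindex r d -> R},
    forall x, monomial (x - z) (mi_val i) = poly_fun t x.
Proof.
pose c (j : {ffun 'I_d -> 'I_r.+1}) : R :=
  \prod_k (if (j k <= val i k)%N
           then (- z 0 k) ^+ (val i k - j k) *+ 'C(val i k, j k) else 0).
exists [ffun j => c (val j)] => x.
rewrite /monomial; under eq_bigr => k _.
  rewrite ffunE !mxE (exprB_expand _ _ (leq_ord _)).
  over.
rewrite bigA_distr_bigA/= /poly_fun.
pose F (j : {ffun 'I_d -> 'I_r.+1}) : R := c j * \prod_k x 0 k ^+ j k.
transitivity (\sum_j F j); first by apply: eq_bigr => j _; rewrite big_split.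
transitivity (\sum_(j : bmultiindex r d) F (val j)); last first.
  apply: eq_bigr => j _; rewrite ffunE; congr (_ * _).
  by apply: eq_bigr => k _; rewrite ffunE.
rewrite sum_bmultiindex [RHS]big_mkcond/=; apply: eq_bigr => j _.
case: ifPn => // hj; rewrite /F /c.
(* An index [j] of order above [r] cannot lie below [i] in every coordinate, so one factor of its
   coefficient vanishes. *)
have [k hk|hall] := pickP (fun k => ~~ (j k <= val i k)%N).
  by rewrite (bigD1 k)//= (negbTE hk) !mul0r.
case/negP: hj; apply: leq_trans (valP i); apply: leq_sum => k _.
by have := hall k => /negbFE.
Qed.

(** This puts the Taylor polynomial at [mu], written in powers of [x - mu], into the regression
    space, whose monomials are centred at the origin. *)
Lemma shifted_poly_poly_fun r z (c : bmultiindex r d -> R) :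
  exists t : {ffun bmultiindex r d -> R},
    forall x, \sum_i c i * monomial (x - z) (mi_val i) = poly_fun t x.
Proof.
have [t ht] := boolp.choice (@monomialB_poly r z).
exists [ffun j => \sum_i c i * t i j] => x.
under eq_bigr => i _ do rewrite ht /poly_fun mulr_sumr.
rewrite exchange_big/=; apply: eq_bigr => j _.
by rewrite ffunE mulr_suml; apply: eq_bigr => i _; rewrite mulrA.
Qed.

End PolyFun.

(** * Tensor Lagrange interpolation on the design grid *)

Section Interpolation.
Context {R : realType} {d : nat}.
Implicit Types (u v a : 'rV[R]_d).

Definition node (l : nat) (s : nat) : R := s%:R - l%:R.

Lemma node_inj l : injective (node l).
Proof. by move=> s t /addIr /eqP; rewrite eqr_nat => /eqP. Qed.

(** Tensor product of univariate Lagrange polynomials. In the coordinates [u], where the grid is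
    {-l, ..., l}^d, it is 1 at the node labelled [g] and 0 at the others. *)
Definition lagrange_basis l (g : grid d l) u : R :=
  \prod_c (tnth (l.*2.+1.-lagrange (node l)) (g c) : {poly R}).[u 0 c].

(** As a polynomial in [u] the left side has degree at most i <= 2 l, so its values at the 2 l + 1
    distinct nodes determine it. *)
Lemma expr_interpolation l i (a delta u : R) : (i <= l.*2)%N ->
  (a + u * delta) ^+ i =
  \sum_(s < l.*2.+1) (a + node l s * delta) ^+ i *
     (tnth (l.*2.+1.-lagrange (node l)) s : {poly R}).[u].
Proof.
move=> il; pose q : {poly R} := a%:P + delta *: 'X.
have qE y : (q ^+ i).[y] = (a + y * delta) ^+ i.
  by rewrite horner_exp /q hornerD hornerC hornerZ hornerX mulrC.
have sq : (size q <= 2)%N.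
  apply: leq_trans (size_polyD _ _) _; rewrite geq_max.
  rewrite (leq_trans (size_polyC_leq1 _))//=.
  by apply: leq_trans (size_scale_leq _ _) _; rewrite size_polyX.
have sqi : (size (q ^+ i) <= l.*2.+1)%N.
  apply: leq_trans (size_poly_exp_leq _ _) _; rewrite ltnS.
  apply: leq_trans il; case: (size q) sq => [|[|[|]]]//= _; rewrite ?mul1n//.
rewrite -qE {1}(lagrange_gen (ltn0Sn l.*2) (@node_inj l) sqi).
rewrite horner_sum; apply: eq_bigr => s _.
by rewrite hornerM hornerC qE.
Qed.

(** No exponent in a monomial exceeds r <= 2 l, so univariate interpolation applies in each
    coordinate; distributing the product gives the sum over the grid. *)
Lemma poly_fun_interpolation r l (t : {ffun bmultiindex r d -> R}) a
    (delta : R) u : (r <= l.*2)%N ->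
  poly_fun t (a + delta *: u) =
  \sum_(g : grid d l) poly_fun t (grid_point a delta g) * lagrange_basis g u.
Proof.
move=> rl; rewrite /poly_fun; under [RHS]eq_bigr do rewrite mulr_suml.
rewrite exchange_big/=; apply: eq_bigr => i _.
under [RHS]eq_bigr do rewrite -mulrA; rewrite -mulr_sumr; congr (_ * _).
rewrite /monomial; under eq_bigr => c _.
  rewrite !mxE (mulrC delta) (@expr_interpolation l); last first.
    by rewrite ffunE (leq_trans _ rl)// leq_ord.
  over.
rewrite bigA_distr_bigA/=; apply: eq_bigr => g _.
rewrite /lagrange_basis -big_split/=; apply: eq_bigr => c _.
by rewrite !mxE.
Qed.

(** A single constant serves as bound and as Lipschitz constant on the cube of radius [rho]. The
    property passes to sums and products, hence to polynomials. *)
Definition bounded_lipschitz (rho : R) (F : 'rV[R]_d -> R) : Prop :=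
  exists2 B : R, 0 < B & forall u v,
    (forall k, `|u 0 k| <= rho) -> (forall k, `|v 0 k| <= rho) ->
    `|F u| <= B /\ `|F u - F v| <= B * enorm (u - v).

Lemma bounded_lipschitz_cst rho c : bounded_lipschitz rho (cst c).
Proof.
exists (`|c| + 1) => [|u v hu hv]; first by rewrite ltr_wpDl.
by rewrite subrr normr0 mulr_ge0 ?enorm_ge0 ?addr_ge0// lerDl.
Qed.

Lemma bounded_lipschitz_coord rho k : bounded_lipschitz rho (fun u => u 0 k).
Proof.
exists (`|rho| + 1) => [|u v hu hv]; first by rewrite ltr_wpDl.
split; first by rewrite (le_trans (hu k))// (le_trans (ler_norm _))// lerDl.
have := ler_coord_enorm (u - v) k; rewrite !mxE => /le_trans; apply.
by rewrite ler_peMl ?enorm_ge0// lerDr.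
Qed.

Lemma bounded_lipschitzD rho F G : bounded_lipschitz rho F ->
  bounded_lipschitz rho G -> bounded_lipschitz rho (fun u => F u + G u).
Proof.
move=> [B B0 hF] [C C0 hG]; exists (B + C) => [|u v hu hv]; first exact: addr_gt0.
have [F1 F2] := hF u v hu hv; have [G1 G2] := hG u v hu hv; split.
  by apply: le_trans (ler_normD _ _) (lerD F1 G1).
rewrite opprD addrACA mulrDl; exact: le_trans (ler_normD _ _) (lerD F2 G2).
Qed.

Lemma bounded_lipschitzM rho F G : bounded_lipschitz rho F ->
  bounded_lipschitz rho G -> bounded_lipschitz rho (fun u => F u * G u).
Proof.
move=> [B B0 hF] [C C0 hG]; exists (B * C *+ 2) => [|u v hu hv].
  by rewrite mulrn_wgt0// mulr_gt0.
have [F1 F2] := hF u v hu hv; have [G1 G2] := hG u v hu hv.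
have [G3 _] := hG v u hv hu; split.
  rewrite normrM (le_trans (ler_pM _ _ F1 G1))// mulr2n lerDl.
  by rewrite mulr_ge0// ltW.
have -> : F u * G u - F v * G v = F u * (G u - G v) + (F u - F v) * G v by ring.
apply: le_trans (ler_normD _ _) _; rewrite !normrM.
have := ler_pM (normr_ge0 _) (normr_ge0 _) F1 G2.
have := ler_pM (normr_ge0 _) (normr_ge0 _) F2 G3.
lra.
Qed.

Lemma bounded_lipschitz_horner rho (p : {poly R}) k :
  bounded_lipschitz rho (fun u => p.[u 0 k]).
Proof.
elim/poly_ind: p => [|p c ih].
  have -> : (fun u => (0 : {poly R}).[u 0 k]) = cst 0.
    by apply/funext => u; rewrite horner0.
  exact: bounded_lipschitz_cst.
have -> : (fun u : 'rV[R]_d => (p * 'X + c%:P).[u 0 k]) =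
    (fun u => p.[u 0 k] * u 0 k + cst c u).
  by apply/funext => u; rewrite hornerMXaddC.
apply: bounded_lipschitzD; last exact: bounded_lipschitz_cst.
by apply: bounded_lipschitzM => //; exact: bounded_lipschitz_coord.
Qed.

Lemma bounded_lipschitz_lagrange rho l (g : grid d l) :
  bounded_lipschitz rho (lagrange_basis g).
Proof.
rewrite /lagrange_basis.
have : forall s : seq 'I_d, bounded_lipschitz rho (fun u => \prod_(c <- s)
    (tnth (l.*2.+1.-lagrange (node l)) (g c) : {poly R}).[u 0 c]).
  elim=> [|c s ih].
    under eq_fun do rewrite big_nil; exact: bounded_lipschitz_cst.
  under eq_fun do rewrite big_cons.
  apply: bounded_lipschitzM => //; exact: bounded_lipschitz_horner.
exact.
Qed.

(** [B] is chosen before [t], [a] and [delta]: in the rescaled coordinates the basis functions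
    depend neither on the location nor on the width of the grid. *)
Lemma poly_fun_grid_bound r l : (r <= l.*2)%N ->
  exists2 B : R, 0 < B &
    forall (t : {ffun bmultiindex r d -> R}) a (delta E : R),
    (forall g : grid d l, `|poly_fun t (grid_point a delta g)| <= E) ->
    forall u v, (forall k, `|u 0 k| <= l%:R) -> (forall k, `|v 0 k| <= l%:R) ->
    `|poly_fun t (a + delta *: u)| <= B * E /\
    `|poly_fun t (a + delta *: u) - poly_fun t (a + delta *: v)|
      <= B * E * enorm (u - v).
Proof.
move=> rl.
have H (g : grid d l) : exists B : R, 0 < B /\ forall u v,
    (forall k, `|u 0 k| <= l%:R) -> (forall k, `|v 0 k| <= l%:R) ->
    `|lagrange_basis g u| <= B /\
    `|lagrange_basis g u - lagrange_basis g v| <= B * enorm (u - v).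
  by have [B B0 h] := bounded_lipschitz_lagrange l%:R g; exists B.
have {H}[B hB] := boolp.choice H.
exists (\sum_g B g + 1).
  by rewrite ltr_wpDl// sumr_ge0// => g _; have [/ltW] := hB g.
move=> t a delta E hE u v hu hv.
have E0 : 0 <= E.
  by apply: le_trans (hE [ffun=> ord0]); exact: normr_ge0.
rewrite !(poly_fun_interpolation _ _ _ _ rl) -sumrB; split.
  apply: le_trans (ler_norm_sum _ _ _) _.
  rewrite mulrDl mul1r -[leLHS]addr0 lerD// mulr_suml ler_sum// => g _.
  have [_ /(_ u v hu hv)[h _]] := hB g.
  by rewrite normrM mulrC ler_pM.
apply: le_trans (ler_norm_sum _ _ _) _.
rewrite -mulrA mulrDl mul1r -[leLHS]addr0 lerD ?mulr_ge0 ?enorm_ge0//.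
rewrite mulr_suml ler_sum// => g _.
have [_ /(_ u v hu hv)[_ h]] := hB g.
rewrite -mulrBr normrM mulrCA ler_pM//.
Qed.

End Interpolation.

(** * Least squares controls the error at the grid points *)

Section LeastSquares.
Context {R : realType} {d : nat}.

(** Let h be the difference of the two polynomials on the grid and z the mean residual of [t0] in
    each slot. Equal repetition turns the comparison of residual sums of squares into sum h^2 <= 2
    sum z h, and the right side is at most 2 max |h| sum |z|. *)
Lemma least_squares_grid_bound r l N m (a : 'rV[R]_d) (delta : R)
    (x : nat -> 'rV[R]_d) (slot : nat -> grid d l) (Y : nat -> R)
    (t t0 : {ffun bmultiindex r d -> R}) :
  (0 < m)%N ->
  (forall g, #|[pred k : 'I_N | slot k == g]| = m) ->
  (forall k, (k < N)%N -> x k = grid_point a delta (slot k)) ->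
  least_squares N x Y t ->
  forall g : grid d l, `|poly_fun t (grid_point a delta g) - poly_fun t0 (grid_point a delta g)|
    <= 2 * \sum_(g' : grid d l) `|m%:R^-1 *
         \sum_(k < N | slot k == g') (Y k - poly_fun t0 (grid_point a delta g'))|.
Proof.
move=> m0 hm hx hls.
pose h (g : grid d l) := poly_fun t (grid_point a delta g) - poly_fun t0 (grid_point a delta g).
pose z (g : grid d l) := m%:R^-1 *
  \sum_(k < N | slot k == g) (Y k - poly_fun t0 (grid_point a delta g)).
rewrite -/(\sum_g `|z g|).
have m0' : 0 < m%:R :> R by rewrite ltr0n.
have split (F : nat -> grid d l -> R) :
    \sum_(k < N) F k (slot k) = \sum_g \sum_(k < N | slot k == g) F k g.
  rewrite (partition_big (fun k : 'I_N => slot k) predT)//=.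
  by apply: eq_bigr => g _; apply: eq_bigr => k /eqP ->.
have key : \sum_g h g ^+ 2 <= 2 * \sum_g z g * h g.
  have := hls t0; rewrite /rss -subr_ge0 -sumrB.
  under eq_bigr => k _ do rewrite hx//.
  rewrite (split (fun k g => (Y k - poly_fun t0 (grid_point a delta g)) ^+ 2 -
     (Y k - poly_fun t (grid_point a delta g)) ^+ 2)).
  have -> : \sum_g \sum_(k < N | slot k == g)
      ((Y k - poly_fun t0 (grid_point a delta g)) ^+ 2 -
       (Y k - poly_fun t (grid_point a delta g)) ^+ 2) =
      m%:R * (2 * (\sum_g z g * h g) - \sum_g h g ^+ 2).
    rewrite mulr_sumr -sumrB mulr_sumr; apply: eq_bigr => g _.
    transitivity (\sum_(k < N | slot k == g) (2 * h g *
        (Y k - poly_fun t0 (grid_point a delta g)) - h g ^+ 2)).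
      by apply: eq_bigr => k _; rewrite /h; ring.
    rewrite sumrB -mulr_sumr sumr_const hm /z -mulr_natl.
    by field; rewrite gt_eqF.
  by rewrite pmulr_rge0// subr_ge0.
(* Dividing by the largest |h|, attained at [g0], will remove the square. *)
have [g0 _ hmax] := @arg_maxP _ _ _ ([ffun=> ord0] : grid d l) predT
  (fun g => `|h g|) isT.
have hz : \sum_g z g * h g <= `|h g0| * \sum_g `|z g|.
  rewrite mulr_sumr ler_sum// => g _; rewrite (le_trans (ler_norm _))//.
  by rewrite normrM mulrC ler_wpM2r//; exact: hmax.
have hh : `|h g0| ^+ 2 <= \sum_g h g ^+ 2.
  rewrite (bigD1 g0)//= real_normK ?num_real// lerDl sumr_ge0// => g _.
  exact: sqr_ge0.
move=> g; apply: le_trans (hmax g isT) _.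
have [->|hg0] := eqVneq `|h g0| 0; first by rewrite mulr_ge0// sumr_ge0.
have pos : 0 < `|h g0| by rewrite lt_def hg0 normr_ge0.
rewrite -(ler_pM2l pos) -expr2; nra.
Qed.

End LeastSquares.

(** * Gradients, directional derivatives and local maxima *)

Section Differentiation.
Context {R : realType} {d : nat}.
Implicit Types (x v g h : 'rV[R]_d) (S : set 'rV[R]_d) (F : 'rV[R]_d -> R).

Lemma near_line x v (P : set 'rV[R]_d) : nbhs x P ->
  \forall t \near (0 : R), P (t *: v + x).
Proof.
have : (fun t : R => t *: v + x) t @[t --> (0 : R)] --> 0 *: v + x.
  by apply: cvgD; [apply: cvgZr_tmp; exact: cvg_id|exact: cvg_cst].
by rewrite scale0r add0r => h /h.
Qed.

Lemma gradient_within_derive S F x g k : nbhs x S ->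
  gradient_within S F x g -> 'D_(evec k) F x = g 0 k.
Proof.
move=> Sx hg; rewrite /derive; apply: cvg_lim => //.
apply/cvgrPdist_le => /= e e0.
have H : \forall y \near x,
    `|F y - F x - \sum_k g 0 k * (y 0 k - x 0 k)| <= e * enorm (y - x).
  by apply: filterS2 Sx (hg e e0) => y Sy; apply.
rewrite near_withinE; apply: filterS (near_line (evec k) H) => t.
rewrite addrK enormZ enorm_evec mulr1 => ht t0.
have {}ht : `|F (t *: evec k + x) - F x - g 0 k * t| <= e * `|t|.
  rewrite (bigD1 k)//= big1 ?addr0 in ht; last first.
    by move=> i ik; rewrite !mxE (negbTE ik) /= mulr0 add0r subrr mulr0.
  by rewrite !mxE !eqxx/= mulr1 addrK in ht.
have tn0 : 0 < `|t| by rewrite normr_gt0.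
rewrite -[X in _ - X]/(t^-1 * (F (t *: evec k + x) - F x)).
have -> : g 0 k - t^-1 * (F (t *: evec k + x) - F x) =
    - t^-1 * (F (t *: evec k + x) - F x - g 0 k * t).
  by field; rewrite -normr_gt0.
by rewrite normrM normrN normfV mulrC ler_pdivrMr.
Qed.

(** Along the ray x + s g the expansion gives s |g|^2 - e s |g| <= F (x + s g) - F x <= 0 for small
    s > 0, so |g| <= e for every e > 0. *)
Lemma gradient_within_local_max S F x g : nbhs x S ->
  (\forall y \near x, F y <= F x) -> gradient_within S F x g -> g = 0.
Proof.
move=> Sx hmax hg; apply/eqP; rewrite -enorm_eq0 -normr_le0.
rewrite ger0_norm ?enorm_ge0//; apply/ler_addgt0Pl => e e0; rewrite addr0.
have H : \forall y \near x, F y <= F x /\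
    `|F y - F x - \sum_k g 0 k * (y 0 k - x 0 k)| <= e * enorm (y - x).
  by apply: filterS3 Sx hmax (hg e e0) => y Sy ? h; split => //; exact: h.
have [z0|zn0] := eqVneq (enorm g) 0; first by rewrite z0 ltW.
have zp : 0 < enorm g by rewrite lt_def zn0 enorm_ge0.
have /nbhs_ballP[t /= t0 ht] := near_line g H.
have [] := ht (t / 2).
  rewrite /ball/= sub0r normrN gtr0_norm ?divr_gt0//.
  by rewrite ltr_pdivrMr// mulr_natr mulr2n ltrDl.
have t20 : 0 < t / 2 by rewrite divr_gt0.
rewrite addrK enormZ.
have -> : \sum_k g 0 k * ((t / 2 *: g + x) 0 k - x 0 k) = t / 2 * enorm g ^+ 2.
  rewrite sqr_enorm mulr_sumr; apply: eq_bigr => k _.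
  by rewrite !mxE addrK; ring.
set s := t / 2 in t20 *; move=> h1; rewrite (gtr0_norm t20) ler_norml => /andP[h2 _].
have : s * enorm g * enorm g <= s * enorm g * e by nra.
by rewrite ler_pM2l// mulr_gt0.
Qed.

End Differentiation.

(** * Negative definiteness from the largest eigenvalue *)

Section NegativeDefinite.
Context {R : realType} {d : nat}.
Implicit Types (x y v w : 'rV[R]_d) (A : 'M[R]_d).

Definition dot x y : R := (x *m y^T) 0 0.

Lemma dotE x y : dot x y = \sum_k x 0 k * y 0 k.
Proof. by rewrite /dot mxE; apply: eq_bigr => k _; rewrite mxE. Qed.

Lemma dotDl x y v : dot (x + y) v = dot x v + dot y v.
Proof. by rewrite /dot mulmxDl mxE. Qed.

Lemma dotZl a x v : dot (a *: x) v = a * dot x v.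
Proof. by rewrite /dot -scalemxAl mxE. Qed.

Lemma dotC x y : dot x y = dot y x.
Proof. by rewrite !dotE; apply: eq_bigr => k _; rewrite mulrC. Qed.

Lemma dotDr x y v : dot v (x + y) = dot v x + dot v y.
Proof. by rewrite dotC dotDl !(dotC v). Qed.

Lemma dotZr a x v : dot v (a *: x) = a * dot v x.
Proof. by rewrite dotC dotZl dotC. Qed.

Lemma dot_enorm x : dot x x = enorm x ^+ 2.
Proof. by rewrite dotE sqr_enorm; apply: eq_bigr => k _; rewrite expr2. Qed.

Lemma dot_mulmx_sym A x y : A^T = A -> dot (x *m A) y = dot (y *m A) x.
Proof.
move=> symA; rewrite -{1}symA dotC /dot trmx_mul trmxK.
by rewrite mulmxA.
Qed.

Lemma dot_mulmx_line A x y s : A^T = A ->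
  dot ((x + s *: y) *m A) (x + s *: y) =
  dot (x *m A) x + 2 * s * dot (x *m A) y + s ^+ 2 * dot (y *m A) y.
Proof.
move=> symA; rewrite mulmxDl -scalemxAl !(dotDl, dotZl, dotDr, dotZr).
by rewrite (dot_mulmx_sym y x symA); ring.
Qed.

Lemma dot_mulmxE A x :
  dot (x *m A) x = \sum_i \sum_j x 0 i * A i j * x 0 j.
Proof.
rewrite dotE exchange_big/=; apply: eq_bigr => j _.
by rewrite mxE mulr_suml.
Qed.

Lemma quadratic_form_continuous A : continuous (fun x => dot (x *m A) x).
Proof.
have c i : continuous (fun x : 'rV[R]_d => x 0 i) by exact: coord_continuous.
under eq_fun do rewrite dot_mulmxE.
apply: continuous_big => [|i _]; first exact: add_continuous.
apply: continuous_big => [|j _ x]; first exact: add_continuous.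
apply: (@continuousM _ _ (fun x => x 0 i * A i j) (fun x => x 0 j)); last exact: c.
apply: (@continuousM _ _ (fun x => x 0 i) (cst (A i j))); first exact: c.
exact: cst_continuous.
Qed.

(** The sup norm is at most the Euclidean norm, and the sphere is a level set of the quadratic form
    of the identity matrix. *)
Lemma compact_sphere : compact [set x : 'rV[R]_d | enorm x = 1].
Proof.
apply: bounded_closed_compact.
  exists 1; split; first exact: num_real.
  move=> M M1 x /= hx; apply: le_trans (ltW M1).
  rewrite [leLHS]/Num.norm/= mx_normrE; apply: bigmax_le => // -[i j] _ /=.
  by rewrite ord1 -hx ler_coord_enorm.
have -> : [set x : 'rV[R]_d | enorm x = 1] =
    (fun x => dot (x *m 1%:M) x) @^-1` [set 1].
  apply/seteqP; split=> x /=; rewrite mulmx1 dot_enorm; first by move->; rewrite expr1n.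
  by move/eqP; rewrite -[X in _ == X](expr1n _ 2) eqrXn2 ?enorm_ge0// => /eqP.
apply: closed_comp => [x _|]; first exact: quadratic_form_continuous.
exact: closed_eq.
Qed.

(* A maximizer of the form on the unit sphere is an eigenvector for the maximum. *)
Lemma negative_definite A : (0 < d)%N -> A^T = A -> lambda_max A < 0 ->
  exists2 c : R, 0 < c & forall x, dot (x *m A) x <= - c * enorm x ^+ 2.
Proof.
move=> d0 symA hA.
have [v vS vmax] : exists2 v, v \in [set x : 'rV[R]_d | enorm x = 1] &
    forall t, t \in [set x : 'rV[R]_d | enorm x = 1] ->
      dot (t *m A) t <= dot (v *m A) v.
  apply: (compact_EVT_max (f := fun x => dot (x *m A) x)).
  - by exists (evec (Ordinal d0)) => /=; rewrite enorm_evec.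
  - exact: compact_sphere.
  - by apply: continuous_subspaceT; exact: quadratic_form_continuous.
have v1 : enorm v = 1 by move: vS; rewrite inE.
set lam := dot (v *m A) v in vmax.
have Qle x : dot (x *m A) x <= lam * enorm x ^+ 2.
  have [->|x0] := eqVneq x 0.
    by rewrite mul0mx dot_enorm enorm0 expr0n mulr0.
  have xp : 0 < enorm x by rewrite lt_def enorm_eq0 x0 enorm_ge0.
  have := vmax ((enorm x)^-1 *: x); rewrite inE/= enormZ.
  rewrite ger0_norm ?invr_ge0 ?enorm_ge0// mulVf ?gt_eqF// => /(_ erefl).
  rewrite -scalemxAl dotZl dotZr mulrA -invfM -expr2.
  by rewrite mulrC ler_pdivrMr ?exprn_gt0.
(* [w] is the residual of the eigenvector equation. The form lam |x|^2 - Q(x) is nonnegative and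
   vanishes at [v]; its first-order term along [w] is 2 s |w|^2, which forces [w] to be 0. *)
pose w := lam *: v - v *m A.
have w0 : w = 0.
  apply/eqP; rewrite -enorm_eq0.
  pose b := lam * enorm w ^+ 2 - dot (w *m A) w.
  have b0 : 0 <= b by rewrite subr_ge0.
  pose q := enorm w ^+ 2.
  have q0 : 0 <= q by rewrite exprn_ge0// enorm_ge0.
  have key s : 0 <= 2 * s * q + s ^+ 2 * b.
    have := Qle (v + s *: w); rewrite -subr_ge0.
    suff -> : lam * enorm (v + s *: w) ^+ 2
        - dot ((v + s *: w) *m A) (v + s *: w) = 2 * s * q + s ^+ 2 * b by [].
    have qE : q = lam * dot v w - dot (v *m A) w.
      by rewrite /q -dot_enorm {1}/w dotDl -scaleN1r !dotZl mulN1r.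
    have := dot_mulmx_line v w s (trmx1 R d); rewrite !mulmx1 => E.
    rewrite dot_mulmx_line// -/lam -dot_enorm E qE /b -(dot_enorm w).
    by rewrite [dot v v]dot_enorm v1; ring.
  have b1 : 0 < b + 1 by rewrite ltr_wpDl.
  (* A nearly minimizing s; the denominator is [b + 1] because [b] may be 0. *)
  have := key (- (q / (b + 1))).
  have -> : 2 * - (q / (b + 1)) * q + (- (q / (b + 1))) ^+ 2 * b =
      - (q ^+ 2 * ((b + 2) / (b + 1) ^+ 2)).
    by field; rewrite gt_eqF.
  rewrite oppr_ge0 pmulr_lle0 ?divr_gt0 ?exprn_gt0 ?ltr_wpDl// => q20.
  have : q ^+ 2 == 0 by rewrite eq_le q20 sqr_ge0.
  by rewrite !sqrf_eq0.
have vA : v *m A = lam *: v by apply/eqP; rewrite eq_sym -subr_eq0 -/w w0.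
have v0 : v != 0 by rewrite -enorm_eq0 v1 oner_eq0.
(* [lam] is an eigenvalue and an upper bound of all eigenvalues, so the supremum [lambda_max A] is
   at least [lam]. *)
have lam0 : lam < 0.
  apply: le_lt_trans hA; apply: ub_le_sup; last by apply/eigenvalueP; exists v.
  exists lam => a /eigenvalueP[u uA u0]; have := Qle u.
  rewrite uA dotZl dot_enorm ler_pM2r// exprn_gt0//.
  by rewrite lt_def enorm_eq0 u0 enorm_ge0.
by exists (- lam); rewrite ?oppr_gt0// => x; rewrite opprK.
Qed.

End NegativeDefinite.

(** * Multi-indices, monomials and the terms of order two *)

Section MultiIndices.
Context {R : realType} {d : nat}.
Implicit Types (i j : multiindex d) (k c : 'I_d) (h : 'rV[R]_d).

Definition mi0 : multiindex d := [ffun=> 0%N].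

(** The multi-index e_k + e_c of a second-order derivative. *)
Definition mi_pair (kc : 'I_d * 'I_d) : multiindex d :=
  mi_succ (mi_succ mi0 kc.1) kc.2.

Lemma mi_pairE kc c : mi_pair kc c = ((c == kc.1) + (c == kc.2))%N.
Proof. by rewrite !ffunE. Qed.

Lemma mi_order_succ i k : mi_order (mi_succ i k) = (mi_order i).+1.
Proof.
rewrite /mi_order; under eq_bigr do rewrite ffunE.
rewrite big_split/= -addn1; congr addn.
by rewrite (bigD1 k)//= eqxx big1 ?addn0// => c /negbTE ->.
Qed.

Lemma mi_order_eq0 i : mi_order i = 0%N -> i = mi0.
Proof.
move=> /eqP; rewrite sum_nat_eq0 => /forallP hi.
by apply/ffunP => c; rewrite ffunE; apply/eqP; exact: hi.
Qed.

Lemma mi_order_gt0 i : (0 < mi_order i)%N ->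
  exists k j, i = mi_succ j k /\ mi_order i = (mi_order j).+1.
Proof.
rewrite lt0n sum_nat_eq0 negb_forall => /existsP[k ik].
have E : i = mi_succ [ffun c => (i c - (c == k))%N] k.
  apply/ffunP => c; rewrite !ffunE subnK//.
  by case: eqVneq => // ->; rewrite lt0n.
by exists k, [ffun c => (i c - (c == k))%N]; split => //; rewrite {1}E mi_order_succ.
Qed.

Lemma mi_order_eq2 i : mi_order i = 2%N -> exists kc, i = mi_pair kc.
Proof.
move=> i2; have [|k [j [ij oij]]] := @mi_order_gt0 i; first by rewrite i2.
have [|c [j' [jj' ojj']]] := @mi_order_gt0 j.
  by move: oij; rewrite i2; case: (mi_order j).
have j'0 : j' = mi0.
  by apply: mi_order_eq0; move: oij; rewrite i2 ojj' => -[].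
by exists (c, k); rewrite ij jj' j'0.
Qed.

Lemma mi_fact_succ i k : mi_fact (mi_succ i k) = (mi_fact i * (i k).+1)%N.
Proof.
rewrite /mi_fact (bigD1 k)//= [in RHS](bigD1 k)//= ffunE eqxx addn1 factS.
rewrite [in RHS]mulnC mulnA; congr muln.
by apply: eq_bigr => c /negbTE ck; rewrite ffunE ck addn0.
Qed.

Lemma mi_fact_gt0 i : (0 < mi_fact i)%N.
Proof. by rewrite prodn_gt0// => c; exact: fact_gt0. Qed.

Lemma mi_fact_pair kc : mi_fact (mi_pair kc) = (kc.1 == kc.2).+1.
Proof.
rewrite /mi_pair !mi_fact_succ !ffunE add0n muln1 eq_sym.
by rewrite /mi_fact big1 ?mul1n// => c _; rewrite ffunE.
Qed.

Lemma mi_pair_eq k c k' c' :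
  (mi_pair (k', c') == mi_pair (k, c)) =
  ((k', c') \in [set (k, c); (c, k)]%SET).
Proof.
rewrite !inE; apply/eqP/idP => [E|]; last first.
  case/orP => /eqP[-> ->] //; apply/ffunP => b.
  by rewrite !mi_pairE addnC.
have H b : ((b == k') + (b == c') = (b == k) + (b == c))%N.
  by have := congr1 (fun i : multiindex d => i b) E; rewrite !mi_pairE.
rewrite !xpair_eqE.
have := H k'; rewrite eqxx; case: (eqVneq k' k) => [kk _|_] /=.
  have := H c'; rewrite eqxx -kk => /addnI.
  by case: (eqVneq c' c) => //= ->; rewrite eqxx.
case: (eqVneq k' c) => // kc _; have := H c'; rewrite eqxx kc addnC => /addIn.
by case: (eqVneq c' k).
Qed.

(** For k != c the index e_k + e_c comes from two ordered pairs and has factorial 1; the index 2 e_k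
    comes from one pair and has factorial 2. *)
Lemma card_mi_pair i : mi_order i = 2%N ->
  (#|[pred kc | mi_pair kc == i]| * mi_fact i = 2)%N.
Proof.
case/mi_order_eq2 => -[k c] ->.
have -> : #|[pred kc | mi_pair kc == mi_pair (k, c)]| = #|[set (k, c); (c, k)]%SET|.
  by apply: eq_card => -[k' c']; rewrite inE mi_pair_eq.
by rewrite cards2 mi_fact_pair/= xpair_eqE eq_sym; case: eqVneq.
Qed.

Lemma monomial_succ h i k : monomial h (mi_succ i k) = monomial h i * h 0 k.
Proof.
rewrite /monomial (bigD1 k)//= [in RHS](bigD1 k)//= ffunE eqxx exprD expr1.
rewrite mulrAC; congr (_ * _ * _).
by apply: eq_bigr => c /negbTE ck; rewrite ffunE ck addn0.
Qed.

Lemma monomial0 h : monomial h mi0 = 1.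
Proof. by rewrite /monomial big1// => c _; rewrite ffunE expr0. Qed.

Lemma monomial_pair h kc : monomial h (mi_pair kc) = h 0 kc.1 * h 0 kc.2.
Proof. by rewrite !monomial_succ monomial0 mul1r. Qed.

Lemma ler_monomial h i : `|monomial h i| <= enorm h ^+ mi_order i.
Proof.
rewrite /monomial normr_prod /mi_order -prodrXr ler_prod// => c _.
by rewrite normrX exprn_ge0//= lerXn2r ?nnegrE ?enorm_ge0// ler_coord_enorm.
Qed.

Lemma mi_val_inj r : injective (@mi_val d r).
Proof.
move=> a b E; apply/val_inj/ffunP => c; apply/val_inj.
by have := congr1 (fun i : multiindex d => i c) E; rewrite !ffunE.
Qed.

Lemma mi_val_surj r i : (mi_order i <= r)%N ->
  exists b : bmultiindex r d, mi_val b = i.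
Proof.
move=> ir; pose f : {ffun 'I_d -> 'I_r.+1} := [ffun c => inord (i c)].
have fE c : f c = i c :> nat.
  rewrite ffunE inordK// ltnS (leq_trans _ ir)//.
  by rewrite /mi_order (bigD1 c)//= leq_addr.
have hf : (\sum_(k < d) f k <= r)%N by under eq_bigr do rewrite fE.
by exists (exist _ f hf); apply/ffunP => c; rewrite ffunE fE.
Qed.

(** Turns the order-two terms of the Taylor polynomial into half the Hessian form: by
    [card_mi_pair], a sum over ordered pairs counts the index i exactly 2 / i! times. *)
Lemma sum_order2 r (H : multiindex d -> R) : (2 <= r)%N ->
  \sum_(b : bmultiindex r d | mi_order (mi_val b) == 2%N)
     (mi_fact (mi_val b))%:R^-1 * H (mi_val b) =
  2^-1 * \sum_k \sum_c H (mi_pair (k, c)).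
Proof.
move=> r2; rewrite pair_big/=.
have pair_ex kc : exists b : bmultiindex r d, mi_val b = mi_pair kc.
  by apply: mi_val_surj; rewrite !mi_order_succ /mi_order big1// => c _; rewrite ffunE.
transitivity (2^-1 * \sum_kc \sum_(b : bmultiindex r d |
    (mi_order (mi_val b) == 2%N) && (mi_pair kc == mi_val b)) H (mi_val b)); last first.
  congr (_ * _); apply: eq_bigr => -[k c] _ /=.
  have [b hb] := pair_ex (k, c).
  rewrite (big_pred1 b) ?hb// => b' /=; rewrite -hb (inj_eq (@mi_val_inj r)) andbC (eq_sym b).
  have [->|//] := eqVneq b' b.
  by rewrite hb !mi_order_succ /mi_order big1// => c' _; rewrite ffunE.
rewrite (exchange_big_dep (fun b => mi_order (mi_val b) == 2%N))/=; last by move=> kc b _ /andP[].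
rewrite mulr_sumr; apply: eq_bigr => b b2.
under [X in _ = _ * X]eq_bigl => kc do rewrite b2 /=.
rewrite sumr_const -[X in _ = _ * X]mulr_natl mulrA; congr (_ * _).
have := card_mi_pair (eqP b2); set m := #|_| => hm.
have := congr1 (fun n => n%:R : R) hm; rewrite natrM => {}hm.
have f0 : (mi_fact (mi_val b))%:R != 0 :> R by rewrite pnatr_eq0 -lt0n mi_fact_gt0.
apply: (mulfI f0); rewrite mulfV// mulrCA (mulrC _ m%:R) hm.
by rewrite mulVf// pnatr_eq0.
Qed.

End MultiIndices.

(** * The Taylor polynomial near the maximizer *)

Section LocalTaylor.
Context {R : realType} {d : nat}.
Implicit Types (x mu : 'rV[R]_d) (D : set 'rV[R]_d) (f : 'rV[R]_d -> R).

(** First-order terms vanish, order-two terms make up the quadratic form, and each term of order at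
    least three is at most |co b| |h|^3 because |h| <= 1. *)
Lemma taylor_expansion r (Df : multiindex d -> 'rV[R]_d -> R) mu :
  (2 <= r)%N -> (forall k, Df (mi_succ mi0 k) mu = 0) ->
  exists2 B : R, 0 <= B & forall x, enorm (x - mu) <= 1 ->
    taylor r Df mu x <= Df mi0 mu
      + 2^-1 * dot ((x - mu) *m \matrix_(k, c) Df (mi_pair (k, c)) mu) (x - mu)
      + B * enorm (x - mu) ^+ 3.
Proof.
move=> r2 grad0.
pose co (b : bmultiindex r d) := (mi_fact (mi_val b))%:R^-1 * Df (mi_val b) mu.
exists (\sum_b `|co b|) => [|x hx]; first exact: sumr_ge0.
set h := x - mu in hx *.
pose o (b : bmultiindex r d) := mi_order (mi_val b).
rewrite /taylor -/h (bigID (fun b => o b == 2%N))/=.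
rewrite [X in X + _](_ : _ = 2^-1 * dot (h *m \matrix_(k, c) Df (mi_pair (k, c)) mu) h); last first.
  rewrite dot_mulmxE.
  under eq_bigr do rewrite -mulrA.
  rewrite (sum_order2 (fun i => Df i mu * monomial h i))//; congr (_ * _).
  apply: eq_bigr => k _; apply: eq_bigr => c _.
  by rewrite monomial_pair !mxE/=; ring.
rewrite [Df _ _ + _]addrC -addrA lerD2l.
have [b0 hb0] : exists b : bmultiindex r d, mi_val b = mi0.
  by apply: mi_val_surj; rewrite /mi_order big1// => c _; rewrite ffunE.
have o0 : o b0 = 0%N by rewrite /o hb0 /mi_order big1// => c _; rewrite ffunE.
rewrite (bigD1 b0) ?o0//= hb0 monomial0 mulr1.
rewrite [X in X^-1](_ : _ = 1) ?invr1 ?mul1r; last first.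
  by rewrite /mi_fact big1// => c _; rewrite ffunE.
rewrite lerD2l mulr_suml big_mkcond/= ler_sum// => b _.
have nn : 0 <= `|co b| * enorm h ^+ 3 by rewrite mulr_ge0// exprn_ge0// enorm_ge0.
case: ifPn => // /andP[ob2 bb0].
have ob0 : o b != 0%N.
  apply: contra bb0 => /eqP/mi_order_eq0 E; apply/eqP/(@mi_val_inj _ r).
  by rewrite E hb0.
have [ob1|ob1] := eqVneq (o b) 1%N.
  have [|k [j [E oE]]] := @mi_order_gt0 _ (mi_val b); first by rewrite -/(o b) ob1.
  have j0 : j = mi0 by apply: mi_order_eq0; move: oE; rewrite -/(o b) ob1 => -[].
  by rewrite {2}E j0 grad0 mulr0 mul0r.
have ob3 : (3 <= o b)%N by move: (o b) ob0 ob1 ob2 => [|[|[|]]].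
apply: le_trans (ler_norm _) _; rewrite normrM -/(co b) ler_wpM2l//.
apply: le_trans (ler_monomial _ _) _; rewrite -/(o b).
by rewrite -(subnK ob3) exprD ler_piMl ?exprn_ge0 ?enorm_ge0// exprn_ile1 ?enorm_ge0.
Qed.

Lemma nbhs_enorm mu (S : set 'rV[R]_d) : nbhs mu S ->
  exists2 rho : R, 0 < rho & forall x, enorm (x - mu) <= rho -> S x.
Proof.
move=> /nbhs_ballP[e /= e0 he]; exists (e / 2); first by rewrite divr_gt0.
move=> x hx; apply: he; split=> // i j; rewrite ord1 /ball/= distrC.
have := ler_coord_enorm (x - mu) j; rewrite !mxE => hj.
rewrite (le_lt_trans hj)// (le_lt_trans hx)//.
by rewrite ltr_pdivrMr// mulr_natr mulr2n ltrDl.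
Qed.

Lemma subset_fattening D (eps : R) : 0 < eps -> D `<=` fattening D eps.
Proof. by move=> e0 x Dx; exists x => //; rewrite subrr enorm0 ltW. Qed.

Lemma mi_order0 : mi_order (mi0 : multiindex d) = 0%N.
Proof. by rewrite /mi_order big1// => c _; rewrite ffunE. Qed.

(** First derivatives of [f] are identified with [Df] on the whole interior of [D], hence near [mu],
    so that the identity can be differentiated once more. *)
Lemma hessianE D (eps : R) f Df r mu : (2 <= r)%N -> 0 < eps -> D° mu ->
  partials (fattening D eps) r f Df ->
  hessian f mu = \matrix_(k, c) Df (mi_pair (k, c)) mu.
Proof.
move=> r2 e0 Dmu [Df0 DfS]; apply/matrixP => k c; rewrite !mxE.
have nS x : D° x -> nbhs x (fattening D eps).
  by move=> Dx; apply: filterS Dx; exact: subset_fattening.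
have near_f x : D° x -> \near x, f x = Df mi0 x.
  by move=> /nS; apply: filterS => y Sy; rewrite Df0.
have first x : D° x -> 'D_(evec k) f x = Df (mi_succ mi0 k) x.
  move=> Dx; rewrite (near_eq_derive _ (near_f _ Dx)).
  rewrite (gradient_within_derive (S := fattening D eps) (g := \row_k Df (mi_succ mi0 k) x)).
  - by rewrite mxE.
  - exact: nS.
  - by apply: DfS; [rewrite mi_order0 (leq_trans _ r2)|exact: nbhs_singleton (nS _ Dx)].
have near2 : \near mu, 'D_(evec k) f mu = Df (mi_succ mi0 k) mu.
  have : \forall x \near mu, D° x by exact: nbhs_interior.
  by apply: filterS => x; exact: first.
rewrite (near_eq_derive _ near2).
rewrite (gradient_within_derive (S := fattening D eps)
    (g := \row_c Df (mi_succ (mi_succ mi0 k) c) mu)).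
- by rewrite mxE.
- exact: nS.
- by apply: DfS; [rewrite mi_order_succ mi_order0|exact: nbhs_singleton (nS _ Dmu)].
Qed.

(** At the interior maximizer the gradient vanishes and the Hessian is negative definite, so the
    quadratic term dominates the cubic remainder on a small ball. *)
Lemma taylor_local_max r D (eps : R) f Df mu : (0 < d)%N -> (2 <= r)%N ->
  0 < eps -> partials (fattening D eps) r f Df -> D° mu ->
  (forall y, D y -> f y <= f mu) -> lambda_max (hessian f mu) < 0 ->
  exists rho c : R, [/\ 0 < rho, 0 < c & forall x, enorm (x - mu) <= rho ->
    D x /\ taylor r Df mu x <= f mu - c * enorm (x - mu) ^+ 2].
Proof.
move=> d0 r2 e0 hp Dmu hmax; have [Df0 DfS] := hp.
have Smu : nbhs mu (fattening D eps).
  by apply: filterS Dmu; exact: subset_fattening.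
have Smu' := nbhs_singleton Smu.
have grad0 k : Df (mi_succ mi0 k) mu = 0.
  have := @gradient_within_local_max _ _ _ _ _ (\row_k Df (mi_succ mi0 k) mu) Smu _
    (DfS mi0 _ mu Smu').
  move=> /(_ _ _)/rowP/(_ k); rewrite !mxE; apply.
    apply: filterS Dmu => y Dy; rewrite !Df0 ?hmax//; exact: subset_fattening.
  by rewrite mi_order0 (leq_trans _ r2).
rewrite (hessianE r2 e0 Dmu hp); set A := \matrix_(_, _) _ => hA.
(* Symmetry holds because [Df] depends only on the multi-index and e_k + e_c = e_c + e_k. *)
have symA : A^T = A.
  apply/matrixP => k c; rewrite !mxE; congr (Df _ mu).
  by apply/ffunP => b; rewrite !mi_pairE addnC.
have [c c0 hc] := negative_definite d0 symA hA.
have [B B0 hB] := taylor_expansion r2 grad0.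
have [rho rho0 hrho] := nbhs_enorm Dmu.
have Bc : 0 < c / (4 * (B + 1)) by rewrite divr_gt0// mulr_gt0// ltr_wpDl.
(* Within this radius the remainder is at most (c / 4) |h|^2, which leaves (c / 4) |h|^2 of the
   decrease (c / 2) |h|^2; [B + 1] replaces [B], which may be 0. *)
exists (Num.min rho (Num.min 1 (c / (4 * (B + 1))))), (c / 4); split.
- by rewrite !lt_min rho0 Bc ltr01.
- by rewrite divr_gt0.
move=> x; rewrite !le_min => /and3P[h1 h2 h3]; split; first exact: hrho.
apply: le_trans (hB _ h2) _; rewrite Df0// -addrA lerD2l.
have := hc (x - mu); rewrite -/A; set q := dot _ _; set z := enorm _ in h3 *.
have z0 : 0 <= z by exact: enorm_ge0.
have h4 : (B + 1) * z <= c / 4.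
  have -> : c / 4 = (B + 1) * (c / (4 * (B + 1))).
    by field; rewrite gt_eqF// ltr_wpDl.
  by rewrite ler_pM2l// ltr_wpDl.
have h5 : B * z ^+ 3 <= c / 4 * z ^+ 2.
  rewrite [z ^+ 3]exprS mulrA ler_wpM2r ?exprn_ge0//.
  by apply: le_trans h4; rewrite ler_wpM2r// lerDl.
lra.
Qed.

Lemma taylor_self r (Df : multiindex d -> 'rV[R]_d -> R) mu :
  taylor r Df mu mu = Df mi0 mu.
Proof.
have [b0 hb0] : exists b : bmultiindex r d, mi_val b = mi0.
  by apply: mi_val_surj; rewrite mi_order0.
rewrite /taylor (bigD1 b0)//= hb0 monomial0 big1 ?addr0 ?mulr1.
  by rewrite /mi_fact big1 ?invr1 ?mul1r// => c _; rewrite ffunE.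
move=> b bb0; have [|k [j [E _]]] := @mi_order_gt0 _ (mi_val b).
  rewrite lt0n; apply: contra bb0 => /eqP/mi_order_eq0 E.
  by apply/eqP/(@mi_val_inj _ r); rewrite E hb0.
by rewrite [X in monomial _ X]E monomial_succ subrr mxE !mulr0.
Qed.

End LocalTaylor.

(** * Chebyshev's inequality for sums of errors *)

Section Noise.
Local Open Scope ereal_scope.
Context {disp : measure_display} {Om : measurableType disp} {R : realType}.
Variable P : probability Om R.

(** For a centred variable the variance is the integral of the square. *)
Lemma centered_variance (X : {RV P >-> R}) (s : R) :
  'E_P[X] = 0 -> 'V_P[X] = s%:E -> (X : Om -> R) \in Lfun P 2%:E.
Proof.
move=> EX VX; apply/andP; split; rewrite inE/=.
  exact: measurable_funPT.
rewrite /finite_norm unlock.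
rewrite poweR_lty//.
suff -> : \int[P]_x (`|(X x)%:E| `^ 2) = s%:E by exact: ltry.
rewrite -VX /variance [in RHS]unlock EX/= [in RHS]unlock.
apply: eq_integral => w _; rewrite !fctE /= subr0 powR_mulrn//.
by rewrite real_normK ?num_real// expr2.
Qed.

Lemma integrable_distribution (X : {RV P >-> R}) :
  (X : Om -> R) \in Lfun P 1 ->
  (distribution P X).-integrable setT (EFin : R -> \bar R).
Proof.
move/Lfun1_integrable => /integrableP[_ hX].
apply/integrableP; split; first exact: EFin_measurable.
rewrite ge0_integral_distribution//.
by apply/measurableT_comp => //; exact: EFin_measurable.
Qed.

(** By independence the joint law is the product of the marginal laws; by Fubini the inner integral
    is x E[Y] = 0. *)
Lemma expectation_mul_independent (X Y : {RV P >-> R}) :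
  (X : Om -> R) \in Lfun P 2%:E -> (Y : Om -> R) \in Lfun P 2%:E ->
  'E_P[Y] = 0 ->
  (forall A B, measurable A -> measurable B ->
     P (X @^-1` A `&` Y @^-1` B) = P (X @^-1` A) * P (Y @^-1` B)) ->
  'E_P[(X * Y)%R] = 0.
Proof.
move=> X2 Y2 EY0 indep.
have Pfin : P setT \is a fin_num := fin_num_measure P _ measurableT.
have Y1 := Lfun_subset12 Pfin Y2.
have XY1 := Lfun2_mul_Lfun1 X2 Y2.
have mZ : measurable_fun setT (fun w => (X w, Y w)).
  by apply: measurable_fun_pair; exact: measurable_funPT.
pose Z : {RV P >-> (R * R)%type} := mfun_Sub (mem_set mZ).
pose f (z : R * R) := (z.1 * z.2)%:E.
have mf : measurable_fun setT f.
  apply/measurable_EFinP; apply: measurable_funM.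
    exact: measurable_fst.
  exact: measurable_snd.
have fZ : P.-integrable setT (f \o Z) by move/Lfun1_integrable: XY1.
have eqm : forall A, measurable A -> A `<=` setT ->
    (distribution P X \x distribution P Y) A = distribution P Z A.
  move=> A mA _; apply: product_measure_unique mA => B C mB mC.
  exact: indep.
rewrite unlock.
transitivity (\int[distribution P Z]_z f z); first by rewrite integral_distribution.
rewrite -(eq_measure_integral _ eqm).
rewrite -integral12_prod_meas1//.
  rewrite /fubini_F [RHS](_ : 0 = \int[distribution P X]_x (cst 0 x)); last by rewrite integral_cst// mul0e.
  apply: eq_integral => x _ /=; rewrite /f/=.
  under eq_integral do rewrite EFinM.
  rewrite integralZl//; last exact: integrable_distribution.
  rewrite [X in _ * X](_ : _ = 0) ?mule0//.
  rewrite -EY0 expectation_def integral_distribution//.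
  by move/Lfun1_integrable: Y1.
apply/integrableP; split => //.
rewrite (eq_measure_integral _ eqm) ge0_integral_distribution//; last first.
  exact: measurableT_comp.
by move/integrableP: fZ => [].
Qed.

Lemma variance_sum_uncorrelated (s : seq nat) (X : nat -> {RV P >-> R}) (v : R) :
  uniq s -> (forall k, k \in s -> 'E_P[X k] = 0 /\ 'V_P[X k] = v%:E) ->
  (forall k k', k \in s -> k' \in s -> k != k' -> 'E_P[(X k * X k')%R] = 0) ->
  exists S : {RV P >-> R},
   [/\ (S : Om -> R) = (fun w => (\sum_(k <- s) X k w)%R),
       (S : Om -> R) \in Lfun P 2%:E, 'E_P[S] = 0 &
       'V_P[S] = ((size s)%:R * v)%:E].
Proof.
have Pfin : P setT \is a fin_num := fin_num_measure P _ measurableT.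
move=> us hE hC.
have L2 k : k \in s -> (X k : Om -> R) \in Lfun P 2%:E.
  by move=> ks; have [e1 e2] := hE k ks; exact: centered_variance e1 e2.
(* The induction also carries the zero covariance with every variable not yet added, which makes the
   variances add up. *)
suff H : forall s', uniq s' -> {subset s' <= s} ->
   [/\ (fun w => (\sum_(k <- s') X k w)%R) \in Lfun P 2%:E,
       'E_P[(fun w => (\sum_(k <- s') X k w)%R)] = 0,
       'V_P[(fun w => (\sum_(k <- s') X k w)%R)] = ((size s')%:R * v)%:E &
       forall k, k \in s -> k \notin s' ->
         covariance P (X k) (fun w => (\sum_(k <- s') X k w)%R) = 0].
  have [//|S2 ES VS _] := H s us.
  have mS := sub_Lfun_mfun S2.
  by exists (mfun_Sub mS).
elim=> [_ _|k s' ih /=/andP[ks' us'] sub].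
  under eq_fun do rewrite big_nil.
  rewrite -/(cst 0%R) expectation_cst variance_cst mul0r; split=> //.
    exact: Lfun_cst.
  by move=> k _ _; exact: covariance_cst_r.
have [|S2 ES VS CS] := ih us'; first by move=> i is'; apply: sub; rewrite inE is' orbT.
have ks : k \in s by apply: sub; rewrite mem_head.
have k2 := L2 k ks.
have E : (fun w => (\sum_(i <- k :: s') X i w)%R) =
    ((X k : Om -> R) \+ (fun w => \sum_(i <- s') X i w))%R.
  by apply/funext => w; rewrite big_cons.
have [Ek Vk] := hE k ks.
rewrite E; split.
- by rewrite rpredD ?lee1n//=.
- by rewrite expectationD ?Lfun_subset12// Ek ES adde0.
- rewrite varianceD// CS// mule0 adde0 Vk VS -EFinD -[(size s').+1]add1n natrD.
  by rewrite mulrDl mul1r.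
- move=> j js; rewrite inE negb_or => /andP[jk js'].
  rewrite covarianceDr ?L2// (CS j)// adde0.
  have [Ej _] := hE j js; have j2 := L2 j js.
  rewrite (covarianceE (Lfun_subset12 Pfin j2) (Lfun_subset12 Pfin k2)
    (Lfun2_mul_Lfun1 j2 k2)).
  by rewrite hC// Ek Ej mul0e sube0.
Qed.

Lemma chebyshev_sum (s : seq nat) (X : nat -> {RV P >-> R}) (v eps : R) :
  uniq s -> (forall k, k \in s -> 'E_P[X k] = 0 /\ 'V_P[X k] = v%:E) ->
  (forall k k', k \in s -> k' \in s -> k != k' -> 'E_P[(X k * X k')%R] = 0) ->
  (0 < eps)%R ->
  measurable [set w | (eps <= `|\sum_(k <- s) X k w|)%R] /\
  P [set w | (eps <= `|\sum_(k <- s) X k w|)%R] <= (eps ^- 2 * ((size s)%:R * v))%:E.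
Proof.
move=> us hE hC e0; have [S [SE S2 ES VS]] := variance_sum_uncorrelated us hE hC.
have E w : (\sum_(k <- s) X k w)%R = S w by rewrite SE.
under eq_set do rewrite E.
split.
  rewrite -[X in measurable X]setTI.
  have m : measurable_fun setT (fun w => `|S w|%R).
    by apply: measurableT_comp => //; exact: measurable_funPT.
  have := m measurableT `[eps, +oo[%classic (measurable_itv _).
  rewrite (_ : _ @^-1` _ = [set w | (eps <= `|S w|)%R])//.
  by apply/seteqP; split=> w /=; rewrite in_itv/= andbT.
have := chebyshev S e0; rewrite ES/= VS -EFinM.
by under eq_set do rewrite subr0.
Qed.

Lemma independent_pair (I : choiceType) (J : set I) (X : I -> {RV P >-> R}) i j :
  mutually_independent J X -> J i -> J j -> i != j ->
  forall A B, measurable A -> measurable B ->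
    P (X i @^-1` A `&` X j @^-1` B) = P (X i @^-1` A) * P (X j @^-1` B).
Proof.
move=> ind Ji Jj ij A B mA mB.
pose C k := if k == i then A else B.
have := ind [fset i; j]%fset C _ _; rewrite big_fsetU1/= ?inE// big_seq_fset1.
rewrite /C eqxx eq_sym (negbTE ij) => <-.
- congr (P _); apply/seteqP; split => [w [Aw Bw] k /=|w h].
    by rewrite !inE => /orP[]/eqP ->; rewrite ?eqxx// eq_sym (negbTE ij).
  have := h i; rewrite eqxx => hi; have := h j; rewrite eq_sym (negbTE ij) => hj.
  by split; [apply: hi|apply: hj]; rewrite /= !inE eqxx ?orbT.
- by move=> k /=; rewrite !inE => /orP[]/eqP ->.
- by move=> k; case: ifP.
Qed.

End Noise.

(** * Deterministic analysis of one stage *)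

Section OneStage.
Context {R : realType}.

Lemma holder_degree_ge2 (alpha : R) : 2 < alpha -> (2 <= holder_degree alpha)%N.
Proof.
move=> a2; have h : 1 < Num.ceil (alpha - 1) by rewrite ceil_gt_int; lra.
by rewrite /holder_degree; move: h; case: Num.ceil.
Qed.

Lemma leq_grid_radius r : (r <= (grid_radius r).*2)%N.
Proof. by rewrite /grid_radius; lia. Qed.

Lemma grid_radius_gt0 r : (2 <= r)%N -> (0 < grid_radius r)%N.
Proof. by rewrite /grid_radius; lia. Qed.

Lemma node_bound l s : (s <= l.*2)%N -> `|node l s : R| <= l%:R.
Proof.
move=> sl; rewrite /node ler_norml -{1}(add0r (l%:R : R)) opprD.
have h : (s%:R : R) <= l.*2%:R by rewrite ler_nat.
move: h; rewrite -addnn natrD => h.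
by have s0 : 0 <= s%:R :> R by []; apply/andP; split; lra.
Qed.

(** The noise enters only through the slot means and the previous estimator only through |a - mu| <=
    delta. [C] and [delta0] are fixed before all of these, so the bound can be applied outcome by
    outcome. *)
Lemma second_stage_bound (alpha : R) d (D : set 'rV[R]_d) (eps L : R)
    (f : 'rV[R]_d -> R) (mu : 'rV[R]_d) :
  let r := holder_degree alpha in
  let l := grid_radius r in
  let Deps := fattening D eps in
  2 < alpha -> (0 < d)%N -> 0 < eps -> 0 < L -> holder_class alpha L Deps f ->
  D° mu -> (forall y, D y -> f y <= f mu) -> lambda_max (hessian f mu) < 0 ->
  exists C delta0 : R, [/\ 0 < C, 0 < delta0 &
    forall (a : 'rV[R]_d) (delta T : R) (N m : nat) (x : nat -> 'rV[R]_d)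
      (slot : nat -> grid d l) (xi : nat -> R)
      (t : {ffun bmultiindex r d -> R}) (mu' : 'rV[R]_d),
    0 < delta -> delta <= delta0 -> enorm (a - mu) <= delta -> 0 <= T ->
    (0 < m)%N -> (forall g, #|[pred k : 'I_N | slot k == g]| = m) ->
    (forall k, (k < N)%N -> x k = grid_point a delta (slot k)) ->
    least_squares N x (fun k => patch (fun=> 0) Deps f (x k) + xi k) t ->
    is_argmax (cube a (l%:R * delta)) (poly_fun t) mu' ->
    (forall g, `|m%:R^-1 * \sum_(k < N | slot k == g) xi k| <= T * delta `^ alpha) ->
    enorm (mu' - mu) <= C * (1 + T) * delta `^ (alpha - 1) /\
    `|poly_fun t mu' - f mu| <= C * (1 + T) * delta `^ alpha].
Proof.
move=> r l Deps a2 d0 eps0 L0 [Df [hp hH]] Dmu hmax hess.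
have r2 : (2 <= r)%N by exact: holder_degree_ge2.
have l0 : (0 < l)%N by exact: grid_radius_gt0.
have l1 : 1 <= l%:R :> R by rewrite ler1n.
have rl : (r <= l.*2)%N by exact: leq_grid_radius.
have a0 : 0 < alpha by lra.
have subD : D `<=` Deps by exact: subset_fattening.
have Dmu' : Deps mu by apply: subD; exact: nbhs_singleton Dmu.
have [rho [c [rho0 c0 hT]]] := taylor_local_max d0 r2 eps0 hp Dmu hmax hess.
have [B B0 hB] := @poly_fun_grid_bound R d r l rl.
have [t0 ht0] := shifted_poly_poly_fun mu
  (fun i : bmultiindex r d => (mi_fact (mi_val i))%:R^-1 * Df (mi_val i) mu).
have {}ht0 y : taylor r Df mu y = poly_fun t0 y by rewrite -ht0.
have t0mu : poly_fun t0 mu = f mu.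
  by rewrite -ht0 taylor_self (proj1 hp).
(* In each coordinate a point of the search cube is within l delta + delta <= 2 l delta of [mu]; the
   factor [d] passes to the Euclidean norm. *)
pose Cd : R := d%:R * (2 * l%:R).
have Cd0 : 0 < Cd by rewrite mulr_gt0 ?ltr0n// mulr_gt0// ltr0n.
pose G : R := #|{: grid d l}|%:R.
have G0 : 0 <= G by [].
(* 2 (G + 1) covers the sum over slots in [least_squares_grid_bound], L Cd^alpha the Hoelder bias
   and 1 the noise. *)
pose C1 := 2 * (G + 1) * (L * Cd `^ alpha + 1).
have LC0 : 0 <= L * Cd `^ alpha by rewrite mulr_ge0 ?powR_ge0// ltW.
have C10 : 0 < C1 by rewrite mulr_gt0 ?ltr_wpDl// mulr_gt0// ltr_wpDl.
(* [B * C1] is for the value and [B * C1 / c] for the location; delta <= rho / Cd keeps the cube in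
   the ball of [taylor_local_max]. *)
exists (B * C1 + B * C1 / c), (rho / Cd); split.
- by rewrite addr_gt0 ?divr_gt0// mulr_gt0.
- exact: divr_gt0.
move=> a delta T N m x slot xi t mu' dl0 dl1 ha T0 m0 hm hx hls [mu'C hmu'] hxi.
have m0' : m%:R != 0 :> R by rewrite pnatr_eq0 -lt0n.
have dlC : Cd * delta <= rho by rewrite mulrC -ler_pdivlMr.
have ha' k : `|a 0 k - mu 0 k| <= delta.
  by have := ler_coord_enorm (a - mu) k; rewrite !mxE => /le_trans; apply.
have ldl : delta <= l%:R * delta by rewrite ler_peMl// ltW.
have near_mu (y : 'rV[R]_d) : (forall k, `|y 0 k - a 0 k| <= l%:R * delta) ->
    enorm (y - mu) <= Cd * delta.
  move=> hy; rewrite /Cd -mulrA; apply: enorm_le_unif => k; rewrite !mxE.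
  have -> : y 0 k - mu 0 k = (y 0 k - a 0 k) + (a 0 k - mu 0 k) by ring.
  apply: le_trans (ler_normD _ _) _.
  by have := hy k; have := ha' k; lra.
have near_grid (g : grid d l) : enorm (grid_point a delta g - mu) <= Cd * delta.
  apply: near_mu => k; rewrite mxE addrC addKr normrM (gtr0_norm dl0).
  by rewrite ler_pM2r// node_bound// -ltnS ltn_ord.
set pd := delta `^ alpha in hxi *.
have pd0 : 0 <= pd by exact: powR_ge0.
pose E := C1 * (1 + T) * pd.
have T1 : 0 <= 1 + T by rewrite addr_ge0.
have C1ge : 0 <= C1 by exact: ltW.
have Bge : 0 <= B by exact: ltW.
have cge : 0 <= c by exact: ltW.
have dlge : 0 <= delta by exact: ltW.
have E0 : 0 <= E by exact: (mulr_ge0 (mulr_ge0 C1ge T1) pd0).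
have BC1 : 0 <= B * C1 by exact: mulr_ge0.
pose h := [ffun i => t i - t0 i] : {ffun bmultiindex r d -> R}.
have hgrid (g : grid d l) : `|poly_fun h (grid_point a delta g)| <= E.
  rewrite poly_funB.
  apply: le_trans (least_squares_grid_bound t0 m0 hm hx hls g) _.
  have -> : E = 2 * ((G + 1) * ((L * Cd `^ alpha + 1) * (1 + T) * pd)).
    by rewrite /E /C1; ring.
  rewrite ler_pM2l//.
  apply: (@le_trans _ _ (\sum_(g' : grid d l) (L * Cd `^ alpha + 1) * (1 + T) * pd)).
    apply: ler_sum => g' _.
    (* Grid points lie in [D], so [patch] returns [f] there and not the default 0. *)
    have Dg : D (grid_point a delta g').
      by have [] := hT _ (le_trans (near_grid g') dlC).
    have -> : \sum_(k < N | slot k == g')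
        (patch (fun=> 0) Deps f (x k) + xi k - poly_fun t0 (grid_point a delta g')) =
      m%:R * (f (grid_point a delta g') - taylor r Df mu (grid_point a delta g'))
      + \sum_(k < N | slot k == g') xi k.
      under eq_bigr => k /eqP kg.
        rewrite (hx k (ltn_ord k)) kg patchT; last by rewrite inE; exact: subD.
        rewrite -ht0 addrAC; over.
      by rewrite big_split/= sumr_const hm mulr_natl.
    rewrite mulrDr mulKf//; apply: le_trans (ler_normD _ _) _.
    have h1 := hH _ _ (subD _ Dg) Dmu'; have h2 := hxi g'.
    have h3 : L * enorm (grid_point a delta g' - mu) `^ alpha
        <= L * Cd `^ alpha * pd.
      rewrite -mulrA ler_pM2l// -(powRM _ (ltW Cd0) dlge).
      by rewrite ge0_ler_powR ?nnegrE ?enorm_ge0 ?mulr_ge0 ?(ltW a0) ?(ltW Cd0).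
    have h4 : 0 <= L * Cd `^ alpha * T * pd by rewrite mulr_ge0// mulr_ge0.
    rewrite -/r in h1; move: h1 h2 h3 h4; lra.
  rewrite sumr_const -[leLHS]mulr_natl -/G ler_wpM2r ?lerDl//.
  by rewrite !mulr_ge0// addr_ge0.
(* [u] maps the search cube onto the cube of radius l of [poly_fun_grid_bound]. *)
pose u (y : 'rV[R]_d) := delta^-1 *: (y - a).
have uE y : a + delta *: u y = y.
  by rewrite /u scalerA mulfV ?gt_eqF// scale1r addrC subrK.
have ub (y : 'rV[R]_d) : (forall k, `|y 0 k - a 0 k| <= l%:R * delta) ->
    forall k, `|u y 0 k| <= l%:R.
  move=> hy k; rewrite !mxE normrM normfV (gtr0_norm dl0) mulrC.
  by rewrite ler_pdivrMr.
have hmu k : `|mu 0 k - a 0 k| <= l%:R * delta.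
  by rewrite distrC (le_trans (ha' k)).
have cubeP (y : 'rV[R]_d) : cube a (l%:R * delta) y <-> forall k, `|y 0 k - a 0 k| <= l%:R * delta.
  by split=> hy k; have := hy k; rewrite ler_distl.
have hmu'' := (cubeP mu').1 mu'C.
have [b1 b2] := hB h a delta E hgrid (u mu') (u mu) (ub _ hmu'') (ub _ hmu).
have [b3 _] := hB h a delta E hgrid (u mu) (u mu') (ub _ hmu) (ub _ hmu'').
rewrite !uE !poly_funB t0mu in b1 b2 b3.
have [_ hTmu'] := hT _ (le_trans (near_mu _ hmu'') dlC).
rewrite -/r ht0 in hTmu'.
have hopt := hmu' _ ((cubeP mu).2 hmu).
have uu : enorm (u mu' - u mu) = delta^-1 * enorm (mu' - mu).
  rewrite /u -scalerBr enormZ normfV (gtr0_norm dl0).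
  by rewrite opprB addrA subrK.
rewrite uu in b2.
set z := enorm (mu' - mu) in hTmu' b2 *.
have z0 : 0 <= z by exact: enorm_ge0.
have BE : B * E = B * C1 * (1 + T) * pd by rewrite /E; ring.
have pdE : pd / delta = delta `^ (alpha - 1).
  by rewrite /pd powRB ?powRr1 ?ltW// (gt_eqF dl0) implybT.
have nn1 : 0 <= B * C1 * (1 + T) by exact: mulr_ge0.
have nn2 : 0 <= B * C1 / c * (1 + T).
  by rewrite mulr_ge0// divr_ge0.
(* With P the Taylor polynomial and g the fit minus P: P mu' <= f mu bounds the fitted maximum above
   by f mu + B E, and comparison with the fit at [mu] bounds it below by f mu - B E. *)
split; last first.
  have nn3 : 0 <= B * C1 / c * (1 + T) * pd by rewrite mulr_ge0.
  have nn4 : 0 <= c * z ^+ 2 by rewrite mulr_ge0 ?exprn_ge0.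
  rewrite ler_norml !mulrDl -BE; move: b1 b3; rewrite !ler_norml.
  move=> /andP[? ?] /andP[? ?]; apply/andP; split; lra.
(* Optimality of [mu'] gives c z^2 <= P mu - P mu' <= g mu' - g mu, to which the Lipschitz bound
   applies. *)
have key : c * z ^+ 2 <= B * E * delta^-1 * z.
  move: b2; rewrite ler_norml => /andP[? ?]; lra.
have key2 : c * z <= B * E * delta^-1.
  have [->|zn0] := eqVneq z 0.
    by rewrite mulr0 mulr_ge0 ?invr_ge0// mulr_ge0.
  have zp : 0 < z by rewrite lt_def zn0.
  by move: key; rewrite expr2 (mulrA c z z) ler_pM2r.
have -> : (B * C1 + B * C1 / c) * (1 + T) * delta `^ (alpha - 1) =
    B * C1 * (1 + T) * delta `^ (alpha - 1) + B * E * delta^-1 / c.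
  by rewrite BE -pdE; field; rewrite !gt_eqF.
have key3 : z <= B * E * delta^-1 / c by rewrite ler_pdivlMr// mulrC.
apply: (le_trans key3); rewrite lerDr mulr_ge0 ?powR_ge0//.
Qed.

End OneStage.

(** * Comparison of powers of n *)

Section Rates.
Context {R : realType}.

Lemma near_powR_ge (p C : R) : 0 < p -> \forall n \near \oo, C <= n%:R `^ p.
Proof.
move=> p0; have := @nbhs_infty_ger R ((`|C|) `^ p^-1).
apply: filterS => n hn; apply: le_trans (ler_norm C) _.
have -> : `|C| = (`|C| `^ p^-1) `^ p.
  by rewrite -powRrM mulVf ?powRr1// gt_eqF.
by rewrite ge0_ler_powR ?nnegrE ?powR_ge0// ltW.
Qed.

(** [n.+1] keeps the width positive at n = 0 too. *)
Definition local_width (b : R) (n : nat) : R := n.+1%:R `^ (- b).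

Lemma local_width_gt0 b n : 0 < local_width b n.
Proof. exact: powR_gt0. Qed.

Lemma near_local_width_le (b e : R) : 0 < b -> 0 < e ->
  \forall n \near \oo, local_width b n <= e.
Proof.
move=> b0 e0; have := near_powR_ge e^-1 b0; apply: filterS => n hn.
rewrite /local_width powRN -[e]invrK lef_pV2 ?posrE ?powR_gt0 ?invr_gt0//.
apply: le_trans hn _; rewrite ge0_ler_powR ?nnegrE ?(ltW b0)//.
by rewrite ler_nat.
Qed.

Lemma local_width_cvg b : 0 < b -> local_width b n @[n --> \oo] --> (0 : R).
Proof.
move=> b0; apply/cvgrPdist_le => e e0.
have := near_local_width_le b0 e0; apply: filterS => n.
by rewrite sub0r normrN gtr0_norm ?local_width_gt0.
Qed.

(** For n > 0, n + 1 <= 2 n costs a factor 2^b, which the strict gap b < b0 absorbs together with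
    [C]. *)
Lemma near_rate_le_local_width (b b0 C : R) : 0 <= b -> b < b0 ->
  \forall n \near \oo, C * n%:R `^ (- b0) <= local_width b n.
Proof.
move=> bge bb0; have p0 : 0 < b0 - b by rewrite subr_gt0.
have H1 : \forall n \near \oo, (0 < n)%N by exact: nbhs_infty_gt.
have := near_powR_ge (`|C| * 2 `^ b) p0.
apply: filterS2 H1 => n n0 hn.
have nR : 0 < n%:R :> R by rewrite ltr0n.
rewrite /local_width !powRN ler_pdivrMr ?powR_gt0// mulrC ler_pdivlMr ?powR_gt0//.
apply: le_trans (_ : `|C| * n.+1%:R `^ b <= _).
  by rewrite ler_wpM2r ?powR_ge0// ler_norm.
apply: le_trans (_ : `|C| * (2 `^ b * n%:R `^ b) <= _).
  rewrite ler_wpM2l// -powRM// ge0_ler_powR ?nnegrE//.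
  by rewrite -natrM ler_nat mul2n -addnn -addn1 leq_add2l.
rewrite mulrA; apply: le_trans (ler_wpM2r (powR_ge0 _ _) hn) _.
by rewrite -powRD ?subrK// (gt_eqF nR) implybT.
Qed.

Lemma local_width_powR_le (b p : R) n : (0 < n)%N -> 0 <= b * p ->
  local_width b n `^ p <= n%:R `^ (- (b * p)).
Proof.
move=> n0 bp0; rewrite /local_width -powRrM mulNr !powRN.
rewrite lef_pV2 ?posrE ?powR_gt0 ?ltr0n// ge0_ler_powR ?nnegrE//.
by rewrite ler_nat.
Qed.

Lemma near_repetitions_ge (N m : nat -> nat) (q : nat) (c : R) : 0 < c ->
  (forall n, N n = (m n * q)%N) -> (0 < q)%N ->
  (N n)%:R / n%:R @[n --> \oo] --> c ->
  exists2 kappa : R, 0 < kappa &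
    \forall n \near \oo, kappa * n.+1%:R <= (m n)%:R.
Proof.
move=> c0 hN q0 cN; have qR : 0 < q%:R :> R by rewrite ltr0n.
(* One half is lost since N n / n is only eventually above c / 2, the other through n + 1 <= 2 n. *)
exists (c / 4 / q%:R); first by rewrite !divr_gt0.
have c20 : 0 < c / 2 by rewrite divr_gt0.
have H1 : \forall n \near \oo, (0 < n)%N by exact: nbhs_infty_gt.
have H2 : \forall n \near \oo, `|c - (N n)%:R / n%:R| <= c / 2.
  by move/cvgrPdist_le : cN; exact.
apply: filterS2 H1 H2 => n n0; rewrite ler_norml => /andP[_ hn].
have nR : 1 <= n%:R :> R by rewrite ler1n.
have nR0 : 0 < n%:R :> R by rewrite ltr0n.
have {}hn : c / 2 * n%:R <= (N n)%:R.
  by rewrite -ler_pdivlMr//; move: hn; lra.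
rewrite hN natrM in hn.
have nE : n.+1%:R = n%:R + 1 :> R by rewrite natr1.
rewrite mulrAC ler_pdivrMr// nE; apply: le_trans hn.
have : 0 <= c * (n%:R - 1) by rewrite mulr_ge0 ?subr_ge0// ltW.
lra.
Qed.

End Rates.

(** * The averaged noise in the slots *)

Section Stage.
Context {disp : measure_display} {Om : measurableType disp} {R : realType}.
Variable P : probability Om R.

(** Union bound, phrased with measurable exceptional sets. *)
Lemma measurable_cover_seq (I : eqType) (s : seq I) (Q : I -> Om -> Prop) (q : R) :
  (forall i, i \in s -> exists A, [/\ measurable A,
     (P A <= q%:E)%E & forall w, ~ A w -> Q i w]) ->
  exists A, [/\ measurable A, (P A <= ((size s)%:R * q)%:E)%E &
    forall w, ~ A w -> forall i, i \in s -> Q i w].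
Proof.
elim: s => [|i s ih] h.
  by exists set0; rewrite measure0 mul0r; split.
have [|A [mA PA hA]] := ih; first by move=> j js; apply: h; rewrite inE js orbT.
have [|B [mB PB hB]] := h i; first exact: mem_head.
exists (A `|` B); split; first exact: measurableU.
  apply: le_trans (measureU2 _ mA mB) _.
  by rewrite /= -natr1 mulrDl mul1r EFinD leeD.
move=> w /not_orP[wA wB] j; rewrite inE => /orP[/eqP ->|js]; first exact: hB.
exact: hA.
Qed.

(** The labels are deterministic, so each slot mean averages [m n] fixed errors; Chebyshev in each
    slot and a union bound give the order n^(-1/2). *)
Lemma slot_mean_noise_bound (I : finType) (sigma kappa e : R) (N m : nat -> nat)
    (slot : nat -> nat -> I) (xi : nat -> nat -> {RV P >-> R}) :
  0 < kappa -> 0 < e ->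
  (\forall n \near \oo, kappa * n.+1%:R <= (m n)%:R) ->
  (forall n g, #|[pred k : 'I_(N n) | slot n k == g]| = m n) ->
  (forall n k, (k < N n)%N ->
     ('E_P[xi n k] = 0)%E /\ ('V_P[xi n k] = (sigma ^+ 2)%:E)%E) ->
  (forall n k k', (k < N n)%N -> (k' < N n)%N -> k != k' ->
     ('E_P[(xi n k * xi n k')%R] = 0)%E) ->
  exists2 T : R, 0 < T & \forall n \near \oo, exists A, [/\ measurable A,
    (P A <= e%:E)%E & forall w, ~ A w -> forall g,
      `|(m n)%:R^-1 * \sum_(k < N n | slot n k == g) xi n k w|
        <= T * n.+1%:R `^ (- (1 / 2))].
Proof.
move=> ka0 e0 hm hslot hE hC.
pose G : R := #|I|%:R.
have G0 : 0 <= G by [].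
(* The union bound gives probability at most G sigma^2 / (kappa T^2) = e (T - 1) / T^2, which is at
   most e since T >= 1. *)
pose T : R := 1 + G * sigma ^+ 2 / (kappa * e).
have ke0 : 0 < kappa * e by rewrite mulr_gt0.
have T1 : 1 <= T by rewrite lerDl divr_ge0 ?(ltW ke0)// mulr_ge0// sqr_ge0.
have T0 : 0 < T by exact: lt_le_trans ltr01 T1.
exists T => //; apply: filterS hm => n hmn.
have nR : 0 < n.+1%:R :> R by [].
have mR : 0 < (m n)%:R :> R by apply: lt_le_trans hmn; rewrite mulr_gt0.
pose z : R := n.+1%:R `^ (- (1 / 2)).
have z0 : 0 < z by exact: powR_gt0.
have z2 : z ^+ 2 = n.+1%:R^-1.
  rewrite /z -powR_mulrn ?powR_ge0// -powRrM (_ : - (1 / 2) * 2 = -1); last by field.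
  by rewrite powRN powRr1.
have [A [mA PA hA]] : exists A, [/\ measurable A,
   (P A <= ((size (enum I))%:R * (((m n)%:R * (T * z)) ^- 2 * ((m n)%:R * sigma ^+ 2)))%:E)%E
   & forall w, ~ A w -> forall g, g \in enum I ->
    `|(m n)%:R^-1 * \sum_(k < N n | slot n k == g) xi n k w| <= T * z].
  apply: measurable_cover_seq => g _.
  pose s := map val (enum [pred k : 'I_(N n) | slot n k == g]).
  have sN k : k \in s -> (k < N n)%N by move=> /mapP[k' _ ->]; exact: ltn_ord.
  have us : uniq s by rewrite map_inj_uniq ?enum_uniq//; exact: val_inj.
  have ss : size s = m n by rewrite size_map -cardE hslot.
  have sE w : \sum_(k <- s) xi n k w = \sum_(k < N n | slot n k == g) xi n k w.
    by rewrite /s big_map big_enum.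
  have eps0 : 0 < (m n)%:R * (T * z) by exact: (mulr_gt0 mR (mulr_gt0 T0 z0)).
  have [mB PB] := @chebyshev_sum _ _ _ P s (xi n) (sigma ^+ 2) _ us
     (fun k ks => hE n k (sN k ks))
     (fun k k' ks ks' => hC n k k' (sN k ks) (sN k' ks')) eps0.
  rewrite ss in PB.
  exists [set w | (m n)%:R * (T * z) <= `|\sum_(k <- s) xi n k w|]; split => // w.
  move=> /negP; rewrite -ltNge => /ltW hw.
  by rewrite -sE normrM normfV (gtr0_norm mR) mulrC ler_pdivrMr// mulrC.
exists A; split=> // [|w wA g]; last by apply: hA => //; rewrite mem_enum.
apply: le_trans PA _; rewrite lee_fin -cardE -/G.
have -> : G * (((m n)%:R * (T * z)) ^- 2 * ((m n)%:R * sigma ^+ 2)) =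
    G * sigma ^+ 2 * n.+1%:R / (m n)%:R / T ^+ 2.
  rewrite !exprMn z2; field.
  by rewrite !gt_eqF// ltr_wpDl.
have Gs0 : 0 <= G * sigma ^+ 2 by rewrite mulr_ge0// sqr_ge0.
apply: le_trans (_ : G * sigma ^+ 2 / kappa / T ^+ 2 <= _).
  rewrite ler_pM2r ?invr_gt0 ?exprn_gt0// ler_pdivrMr// [leRHS]mulrAC.
  by rewrite -[leRHS]mulrA ler_wpM2l// ler_pdivlMr// mulrC.
rewrite ler_pdivrMr ?exprn_gt0//.
apply: le_trans (_ : e * T <= _); last first.
  by rewrite ler_pM2l// expr2 ler_pMl.
rewrite /T mulrDr mulr1.
have -> : e * (G * sigma ^+ 2 / (kappa * e)) = G * sigma ^+ 2 / kappa.
  by field; rewrite !gt_eqF.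
by rewrite lerDr ltW.
Qed.

End Stage.

(** * The rate of one stage in probability *)

Section StageRate.
Context {R : realType}.

(** Half of the allowed probability e is spent on |a - mu| exceeding the width, half on the noise;
    elsewhere [second_stage_bound] applies. *)
Lemma second_stage_rate (alpha : R) d (D : set 'rV[R]_d) (eps L : R)
    (f : 'rV[R]_d -> R) (mu : 'rV[R]_d)
    (disp : measure_display) (Om : measurableType disp) (P : probability Om R)
    (sigma b b0 c : R) (N m : nat -> nat) :
  let r := holder_degree alpha in
  let l := grid_radius r in
  let Deps := fattening D eps in
  forall (x : nat -> nat -> Om -> 'rV[R]_d) (xi : nat -> nat -> {RV P >-> R})
    (slot : nat -> nat -> grid d l)
    (theta : nat -> Om -> {ffun bmultiindex r d -> R})
    (a mu' : nat -> Om -> 'rV[R]_d),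
  2 < alpha -> (0 < d)%N -> 0 < eps -> 0 < L -> holder_class alpha L Deps f ->
  D° mu -> (forall y, D y -> f y <= f mu) -> lambda_max (hessian f mu) < 0 ->
  0 < b -> b < b0 -> b * alpha <= 1 / 2 ->
  0 < c -> (N n)%:R / n%:R @[n --> \oo] --> c ->
  (forall n, N n = (m n * (2 * l + 1) ^ d)%N) ->
  (forall n k, (k < N n)%N ->
     ('E_P[xi n k] = 0)%E /\ ('V_P[xi n k] = (sigma ^+ 2)%:E)%E) ->
  (forall n k k', (k < N n)%N -> (k' < N n)%N -> k != k' ->
     ('E_P[(xi n k * xi n k')%R] = 0)%E) ->
  (forall n g, #|[pred k : 'I_(N n) | slot n k == g]| = m n) ->
  (forall n k w, (k < N n)%N ->
     x n k w = grid_point (a n w) (local_width b n) (slot n k)) ->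
  (forall n w, least_squares (N n) (fun k => x n k w)
     (fun k => patch (fun=> 0) Deps f (x n k w) + xi n k w) (theta n w)) ->
  (forall n w, is_argmax (cube (a n w) (l%:R * local_width b n))
     (poly_fun (theta n w)) (mu' n w)) ->
  bounded_in_prob P (fun n w => enorm (a n w - mu)) (fun n => n%:R `^ (- b0)) ->
  bounded_in_prob P (fun n w => enorm (mu' n w - mu))
    (fun n => n%:R `^ (- (b * (alpha - 1)))) /\
  bounded_in_prob P (fun n w => poly_fun (theta n w) (mu' n w) - f mu)
    (fun n => n%:R `^ (- (b * alpha))).
Proof.
move=> r l Deps x xi slot theta a mu' a2 d0 eps0 L0 fH Dmu hmax hess.
move=> bp bb0 ba c0 hc hN hE hC hslot hx hls harg ha.
have [C [delta0 [C0 dl0 hstage]]] :=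
  second_stage_bound a2 d0 eps0 L0 fH Dmu hmax hess.
have q0 : (0 < (2 * l + 1) ^ d)%N by rewrite expn_gt0 addn1.
have [kappa ka0 hka] := near_repetitions_ge c0 hN q0 hc.
suff H e : 0 < e -> exists2 C' : R, 0 < C' & \forall n \near \oo,
    exists A : set Om, [/\ measurable A, (P A <= e%:E)%E & forall w, ~ A w ->
      enorm (mu' n w - mu) <= C' * n%:R `^ (- (b * (alpha - 1))) /\
      `|poly_fun (theta n w) (mu' n w) - f mu| <= C' * n%:R `^ (- (b * alpha))].
  split=> e /H[C' C'0 hC']; exists C' => //; apply: filterS hC' => n [A [mA PA hA]];
    exists A; split => // w; apply: contraPP => /hA[h1 h2]; apply/negP.
    by rewrite -leNgt ger0_norm ?enorm_ge0.
  by rewrite -leNgt.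
move=> e0; have e20 : 0 < e / 2 by rewrite divr_gt0.
have [Ca Ca0 hCa] := ha _ e20.
have [T T0 hT] := slot_mean_noise_bound ka0 e20 hka hslot hE hC.
have Tge : 0 <= 1 + T by rewrite addr_ge0// ltW.
exists (C * (1 + T)); first by rewrite mulr_gt0// ltr_wpDl// ltW.
have H1 : \forall n \near \oo, (0 < n)%N by exact: nbhs_infty_gt.
have H2 := near_rate_le_local_width Ca (ltW bp) bb0.
have H3 := near_local_width_le bp dl0.
near=> n.
have n0 : (0 < n)%N by near: n.
have h2 : Ca * n%:R `^ (- b0) <= local_width b n by near: n.
have h3 : local_width b n <= delta0 by near: n.
have [A1 [mA1 A1sub PA1]] : exists A : set Om, [/\ measurable A,
    [set w | Ca * n%:R `^ (- b0) < `|enorm (a n w - mu)|] `<=` A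
    & (P A <= (e / 2)%:E)%E] by near: n.
have [A2 [mA2 PA2 hA2]] : exists A, [/\ measurable A,
    (P A <= (e / 2)%:E)%E & forall w, ~ A w -> forall g,
      `|(m n)%:R^-1 * \sum_(k < N n | slot n k == g) xi n k w|
        <= T * n.+1%:R `^ (- (1 / 2))] by near: n.
have hk : kappa * n.+1%:R <= (m n)%:R by near: n.
have m0 : (0 < m n)%N.
  by rewrite -(ltr_nat R); apply: lt_le_trans hk; rewrite mulr_gt0.
exists (A1 `|` A2); split; first exact: measurableU.
  apply: le_trans (measureU2 _ mA1 mA2) _.
  by rewrite [e in leRHS]splitr EFinD leeD.
move=> w /not_orP[wA1 wA2].
have hw : enorm (a n w - mu) <= local_width b n.
  apply: le_trans h2; rewrite leNgt; apply/negP => h; apply: wA1; apply: A1sub.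
  by rewrite /= ger0_norm ?enorm_ge0.
(* By b alpha <= 1 / 2 the noise level is at most the bias scale delta^alpha. *)
have pw : n.+1%:R `^ (- (1 / 2)) <= local_width b n `^ alpha.
  by rewrite /local_width -powRrM mulNr ler_powR ?ler1n// lerN2.
have [i1 i2] := hstage (a n w) (local_width b n) T (N n) (m n)
  (fun k => x n k w) (slot n) (fun k => xi n k w) (theta n w) (mu' n w)
  (local_width_gt0 b n) h3 hw (ltW T0) m0 (hslot n)
  (fun k kN => hx n k w kN) (hls n w) (harg n w)
  (fun g => le_trans (hA2 w wA2 g) (ler_wpM2l (ltW T0) pw)).
have CT : 0 <= C * (1 + T) by rewrite mulr_ge0// ltW.
have a10 : 0 <= alpha - 1 by lra.
have age : 0 <= alpha by lra.
split.
  apply: le_trans i1 _; rewrite ler_wpM2l// local_width_powR_le//.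
  by rewrite mulr_ge0// ltW.
apply: le_trans i2 _; rewrite ler_wpM2l// local_width_powR_le//.
by rewrite mulr_ge0// ltW.
Unshelve. all: by end_near. Qed.

(** Bernoulli's inequality: q^n >= 1 + n (q - 1). *)
Lemma expr_unbounded (q C : R) : 1 < q -> exists n, C <= q ^+ n.
Proof.
move=> q1; have qp : 0 < q - 1 by rewrite subr_gt0.
have bern n : 1 + n%:R * (q - 1) <= q ^+ n.
  elim: n => [|n ih]; first by rewrite mul0r addr0 expr0.
  rewrite exprS -natr1; apply: le_trans (ler_wpM2l _ ih); last by lra.
  have : 0 <= n%:R * (q - 1) * (q - 1) by rewrite !mulr_ge0// ltW.
  lra.
have C0 : 0 <= `|C| / (q - 1) by rewrite divr_ge0// ltW.
exists (Num.bound (`|C| / (q - 1))); apply: le_trans (bern _).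
have := archi_boundP C0; rewrite ltr_pdivrMr// => h.
by have := ler_norm C; lra.
Qed.

End StageRate.

(** * Choice of the exponents and iteration over the stages *)

Theorem mainTheorem3 (R : realType) (alpha gamma : R)
    (halpha : 2 < alpha) (hgamma : 0 < gamma) :
  let r := holder_degree alpha in
  let l := grid_radius r in
  exists (K : nat) (delta : nat -> nat -> R),
    [/\ (1 <= K)%N,
        (forall j n, (1 <= j <= K)%N -> 0 < delta j n),
        (forall j, (1 <= j <= K)%N -> delta j n @[n --> \oo] --> (0 : R)) &
    forall (d : nat) (D : set 'rV[R]_d) (eps L : R)
      (f : 'rV[R]_d -> R) (mu : 'rV[R]_d)
      (disp : measure_display) (Om : measurableType disp)
      (P : probability Om R) (sigma : R)
      (* for total sample size n: N n j and m n j are the size and the number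
         of repetitions of stage j; observation k of stage j has design point
         x n j k, error xi n j k and (for j > 0) grid label slot n j k *)
      (N m : nat -> nat -> nat)
      (x : nat -> nat -> nat -> Om -> 'rV[R]_d)
      (xi : nat -> nat -> nat -> {RV P >-> R})
      (slot : nat -> nat -> nat -> grid d l)
      (theta : nat -> nat -> Om -> {ffun bmultiindex r d -> R})
      (muhat : nat -> nat -> Om -> 'rV[R]_d),
    let Deps := fattening D eps in
    let Y n j k w := patch (fun=> 0) Deps f (x n j k w) + xi n j k w in
    let Mhat n j w := poly_fun (theta n j w) (muhat n j w) in
    (0 < d)%N -> compact D -> convex_set D ->
    0 < eps -> 0 < L -> holder_class alpha L Deps f ->
    unique (fun z => D° z /\ forall y, D y -> f y <= f z) mu ->
    lambda_max (hessian f mu) < 0 ->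
    (forall n, (\sum_(j < K.+1) N n j)%N = n) ->
    (forall j, (j <= K)%N -> exists2 c : R, 0 < c &
       (N n j)%:R / n%:R @[n --> \oo] --> c) ->
    (forall n j, (1 <= j <= K)%N -> N n j = (m n j * (2 * l + 1) ^ d)%N) ->
    (forall n j k, (j <= K)%N -> (k < N n j)%N ->
       ('E_P[xi n j k] = 0)%E /\ ('V_P[xi n j k] = (sigma ^+ 2)%:E)%E) ->
    (forall n, mutually_independent
       [set jk : nat * nat | (jk.1 <= K)%N /\ (jk.2 < N n jk.1)%N]
       (fun jk => xi n jk.1 jk.2)) ->
    (forall n j, (1 <= j <= K)%N -> independent_systems P
       (data_before (N n) (x n) (Y n) j) (errors_at (N n) (xi n) j)) ->
    (forall n k c, (k < N n 0)%N ->
       measurable_fun setT (fun w => x n 0%N k w 0 c)) ->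
    (forall n w, D (muhat n 0%N w)) ->
    (* estimators are measurable functions of the data *)
    (forall n j, (j <= K)%N ->
       measurable_wrt (data_before (N n) (x n) (Y n) j.+1) (muhat n j)) ->
    (* second-stage operation, from muhat n j to muhat n j.+1 *)
    (forall n j, (j < K)%N -> forall g : grid d l,
       #|[pred k : 'I_(N n j.+1) | slot n j.+1 k == g]| = m n j.+1) ->
    (forall n j k w, (j < K)%N -> (k < N n j.+1)%N ->
       x n j.+1 k w =
         grid_point (muhat n j w) (delta j.+1 n) (slot n j.+1 k)) ->
    (forall n j w, (j < K)%N ->
       least_squares (N n j.+1) (fun k => x n j.+1 k w)
         (fun k => Y n j.+1 k w) (theta n j.+1 w)) ->
    (forall n j w, (j < K)%N ->
       is_argmax (cube (muhat n j w) (l%:R * delta j.+1 n))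
         (poly_fun (theta n j.+1 w)) (muhat n j.+1 w)) ->
    bounded_in_prob P (fun n w => enorm (muhat n 0%N w - mu))
      (fun n => n%:R `^ (- gamma)) ->
    bounded_in_prob P (fun n w => enorm (muhat n K w - mu))
      (fun n => n%:R `^ (- ((alpha - 1) / (2 * alpha)))) /\
    bounded_in_prob P (fun n w => Mhat n K w - f mu)
      (fun n => n%:R `^ (- (1 / 2)))].
Proof.
move=> r l.
(* Stages count from 1, hence [j.-1]. The cap 1 / (2 alpha) is the largest exponent with n^(-1/2) <=
   delta^alpha. *)
pose beta (j : nat) : R :=
  Num.min (1 / (2 * alpha)) (gamma / 2 * (alpha / 2) ^+ j.-1).
have a0 : 0 < alpha by lra.
have aneq : alpha != 0 by rewrite gt_eqF.
have beta0 j : 0 < beta j.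
  rewrite lt_min; apply/andP; split; first by rewrite divr_gt0// mulr_gt0.
  by rewrite mulr_gt0 ?exprn_gt0// divr_gt0.
have betaa j : beta j * alpha <= 1 / 2.
  have -> : 1 / 2 = 1 / (2 * alpha) * alpha by field.
  by rewrite ler_pM2r// ge_min lexx.
(* The exponent reached by the j-th estimator. *)
pose rate (j : nat) : R := if j is 0%N then gamma else beta j * (alpha - 1).
have beta_rate j : beta j.+1 < rate j.
  case: j => [|j] /=.
    rewrite gt_min; apply/orP; right; rewrite expr0 mulr1; lra.
  (* Exponents grow by at most alpha / 2 < alpha - 1 per stage, which leaves the strict gap that
     [second_stage_rate] requires. *)
  apply: (@le_lt_trans _ _ (beta j.+1 * (alpha / 2))); last first.
    by rewrite ltr_pM2l//; lra.
  rewrite [beta j.+2]/beta ge_min [beta j.+1]/beta /=.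
  case: (leP (1 / (2 * alpha)) (gamma / 2 * (alpha / 2) ^+ j)) => _;
    apply/orP; [left|right].
    by rewrite ler_peMr ?divr_ge0 ?mulr_ge0 ?(ltW a0)//; lra.
  by rewrite exprSr mulrA.
(* [K0] factors alpha / 2 lift gamma / 2 to the cap; because of [j.-1], it is stage K0 + 1 that
   attains it. *)
have [K0 hK0] := @expr_unbounded R (alpha / 2) (1 / (2 * alpha) / (gamma / 2)) ltac:(lra).
pose K := K0.+1.
have betaK : beta K = 1 / (2 * alpha).
  by apply/min_idPl => /=; rewrite [leRHS]mulrC -ler_pdivrMr ?divr_gt0.
exists K, (fun j n => local_width (beta j) n); split => //.
- by move=> j n _; exact: local_width_gt0.
- by move=> j _; exact: local_width_cvg.
move=> d D eps L f mu disp Om P sigma N m x xi slot theta muhat Deps Y Mhat.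
move=> d0 _ _ eps0 L0 fH [[Dmu hmax] _] hess _ hNc hN hE hind _ _ _ _ hslot hx hls harg h0.
(* Errors of one stage are pairwise independent and centred, hence uncorrelated. *)
have hC n j k k' : (j < K)%N -> (k < N n j.+1)%N -> (k' < N n j.+1)%N -> k != k' ->
    ('E_P[(xi n j.+1 k * xi n j.+1 k')%R] = 0)%E.
  move=> jK kN k'N kk'.
  have [E1 V1] := hE n j.+1 k jK kN; have [E2 V2] := hE n j.+1 k' jK k'N.
  apply: expectation_mul_independent => //.
  - exact: centered_variance E1 V1.
  - exact: centered_variance E2 V2.
  - apply: (independent_pair (i := (j.+1, k)) (j := (j.+1, k')) (hind n)) => //.
    by rewrite xpair_eqE eqxx.
have step j : (j < K)%N ->
    bounded_in_prob P (fun n w => enorm (muhat n j w - mu)) (fun n => n%:R `^ (- rate j)) ->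
    bounded_in_prob P (fun n w => enorm (muhat n j.+1 w - mu))
      (fun n => n%:R `^ (- rate j.+1)) /\
    bounded_in_prob P (fun n w => Mhat n j.+1 w - f mu)
      (fun n => n%:R `^ (- (beta j.+1 * alpha))).
  move=> jK hj; have [c c0 hc] := hNc j.+1 jK.
  apply: (@second_stage_rate R alpha d D eps L f mu disp Om P sigma (beta j.+1) (rate j) c
    (fun n => N n j.+1) (fun n => m n j.+1) (fun n => x n j.+1)
    (fun n => xi n j.+1) (fun n => slot n j.+1) (fun n => theta n j.+1)
    (fun n => muhat n j) (fun n => muhat n j.+1)) => //.
  - by move=> n; exact: hN.
  - by move=> n k; exact: hE.
  - by move=> n k k'; exact: hC.
  - by move=> n g; exact: hslot.
  - by move=> n k w; exact: hx.
  - by move=> n w; exact: hls.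
  - by move=> n w; exact: harg.
have all_rates j : (j <= K)%N -> bounded_in_prob P
    (fun n w => enorm (muhat n j w - mu)) (fun n => n%:R `^ (- rate j)).
  by elim: j => [//|j ih] jK; have [] := step j jK (ih (ltnW jK)).
have [h1 h2] := step K0 (ltnSn _) (all_rates K0 (leqnSn _)).
move: h1 h2; rewrite /= -/K betaK.
have -> : 1 / (2 * alpha) * (alpha - 1) = (alpha - 1) / (2 * alpha) by field.
have -> : 1 / (2 * alpha) * alpha = 1 / 2 by field.
by [].
Qed.
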